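(* Let $\Omega$ be a bounded smooth domain, let $\mathbb{G}$ be a Green kernel of type $(s,\gamma)$ on $\Omega$ with Green operator $\mathcal{G}$, admitting a $\gamma$-normal derivative $D_\gamma\mathbb{G}$, and let $h\in L^1(\partial\Omega)$. Then there exists a unique $u\in L^1_{loc}(\Omega)$ satisfying $$\int_\Omega u\,\psi=\int_{\partial\Omega}h(z)\,D_\gamma[\mathcal{G}(\psi)](z)\,dz\qquad\text{for any }\psi\in L^\infty_c(\Omega).$$ Furthermore: 1. This unique solution can be represented by $$u(x)=\int_{\partial\Omega}D_\gamma\mathbb{G}(z,x)\,h(z)\,dz,\qquad x\in\Omega.$$ 2. There is a constant $C$ (independent of $h$ and $K$) such that, for every $K\Subset\Omega$, $$\|u\|_{L^\infty(K)}\le C\,\mathrm{dist}(K,\partial\Omega)^{2s-n-\gamma}\,\|h\|_{L^1(\partial\Omega)}.$$ 3. If $h\in C(\partial\Omega)$, then there exists a sequence $(f_j)_{j\in\mathbb{N}}\subset L^1(\Omega,\delta^\gamma)$ such that $\mathcal{G}(f_j)\rightharpoonup u$ weakly in $L^1_{loc}(\Omega)$ as $j\to\infty$.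
   Context: $\Omega\subset\mathbb{R}^n$ ($n\ge1$) and $\delta(x)=\mathrm{dist}(x,\partial\Omega)$. Write $a\wedge b=\min\{a,b\}$. For nonnegative functions, $f\asymp g$ on a set means that there is a constant $C>0$ with $C^{-1}g\le f\le Cg$ on that set. $L^1(\Omega,\delta^\gamma)$ is the set of measurable $f$ on $\Omega$ with $f\delta^\gamma\in L^1(\Omega)$. $L^\infty_c(\Omega)$ is the space of bounded measurable functions with compact support in $\Omega$; $K\Subset\Omega$ means $K$ is a compact subset of $\Omega$. Weak convergence in $L^1_{loc}(\Omega)$ means weak convergence in $L^1(K)$ for every $K\Subset\Omega$. $dz$ on $\partial\Omega$ is surface measure (counting measure if $n=1$). Pointwise identities between $L^1_{loc}$ functions are understood a.e. A Green kernel of type $(s,\gamma)$ on $\Omega$, where $s,\gamma\in(0,1]$ and $2s\le n$, is a measurable function $\mathbb{G}:\Omega\times\Omega\to\mathbb{R}$ such that $\mathbb{G}(x,y)=\mathbb{G}(y,x)$ and $$\mathbb{G}(x,y)\asymp\frac{1}{|x-y|^{n-2s}}\Big(\frac{\delta(x)\delta(y)}{|x-y|^2}\wedge1\Big)^\gamma,\qquad x,y\in\Omega,\ x\ne y.$$ Its Green operator is $\mathcal{G}(f)(x)=\int_\Omega\mathbb{G}(x,y)f(y)\,dy$. $\mathbb{G}$ admits a $\gamma$-normal derivative if there exists a (measurable) function $D_\gamma\mathbb{G}:\partial\Omega\times\Omega\to\mathbb{R}$ such that for every $z\in\partial\Omega$ and every sequence $x_j\in\Omega$ with $x_j\to z$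 one has $\lim_j\mathbb{G}(x_j,\cdot)/\delta(x_j)^\gamma=D_\gamma\mathbb{G}(z,\cdot)$ a.e. in $\Omega$. For a function $u$ on $\Omega$, $D_\gamma u(z)=\lim_{x\to z,\,x\in\Omega}u(x)/\delta(x)^\gamma$ for $z\in\partial\Omega$; this limit exists when $u=\mathcal{G}(\psi)$ with $\psi\in L^\infty_c(\Omega)$. *)

(* Defs.v *)
From HB Require Import structures.
From mathcomp Require Import all_boot all_order all_algebra.
From mathcomp Require Import all_classical all_reals all_analysis.

Set Implicit Arguments.
Unset Strict Implicit.
Unset Printing Implicit Defensive.

Import Order.TTheory GRing.Theory Num.Theory.
Import numFieldNormedType.Exports.

Local Open Scope classical_set_scope.
Local Open Scope ring_scope.

(* The canonical norm of 'rV[R]_n is the sup norm; it is only used through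
   the topology.  All distances below are Euclidean. *)
Definition enorm (R : realType) (n : nat) (v : 'rV[R]_n) : R :=
  Num.sqrt (\sum_(i < n) v 0 i ^+ 2).

Definition set_dist (R : realType) (n : nat) (A B : set 'rV[R]_n) : R :=
  inf [set r | exists x y, [/\ A x, B y & r = enorm (x - y)]].

Definition boundary (T : topologicalType) (A : set T) : set T :=
  closure A `\` A°.

(* delta(x) = dist(x, boundary) *)
Definition delta (R : realType) (n : nat) (Omega : set 'rV[R]_n)
    (x : 'rV[R]_n) : R :=
  set_dist [set x] (boundary Omega).

(* A copy of T on which every set is measurable, so that [mu_ext] yields the
   outer measure A |-> inf { sum_k c (F k) | A included in the union of F }
   with covers by arbitrary sets. *)
Definition all_measurable (T : Type) : Type := T.

HB.instance Definition _ (T : pointedType) := Pointed.on (all_measurable T).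
HB.instance Definition _ (T : pointedType) :=
  @isMeasurable.Build default_measure_display (all_measurable T)
    (@discrete_measurable (all_measurable T)) (@discrete_measurable0 _)
    (@discrete_measurableC _) (@discrete_measurableU _).

Section cover_measure.
Local Open Scope ereal_scope.

Definition cover_measure (R : realType) (T : pointedType)
    (c : set T -> \bar R) : set T -> \bar R :=
  @mu_ext _ (all_measurable T) R c.

(* Infimum of the volumes of the boxes enclosing A: covering by arbitrary
   sets with this gauge amounts to covering by boxes.  The case split only
   matters for n = 0. *)
Definition box_gauge (R : realType) (n : nat) (A : set 'rV[R]_n) : \bar R :=
  if A == set0 then 0 else
  ereal_inf [set v | exists a b : 'rV[R]_n,
    [/\ (forall i, a 0 i <= b 0 i)%R,
        (forall x, A x -> forall i, (a 0 i <= x 0 i <= b 0 i)%R) &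
        v = (\prod_(i < n) (b 0 i - a 0 i))%:E]].

Definition lebesgue_outer (R : realType) (n : nat) :
    set 'rV[R]_n -> \bar R :=
  cover_measure (@box_gauge R n).

Definition diam (R : realType) (n : nat) (A : set 'rV[R]_n) : \bar R :=
  ereal_sup [set d | exists x y, [/\ A x, A y & d = (enorm (x - y))%:E]].

(* Volume of the unit ball of R^m, by the recursion
   omega_(m+2) = 2 pi / (m + 2) * omega_m. *)
Fixpoint ball_volume (R : realType) (m : nat) : R :=
  match m with
  | 0 => 1
  | 1 => 2
  | (m'.+1 as k).+1 => (2 * pi / k.+1%:R * ball_volume R m')%R
  end.

(* With m = 0, every nonempty set has gauge 1, also the singletons, whose
   diameter is 0. *)
Definition hausdorff_gauge (R : realType) (n m : nat) (e : R)
    (A : set 'rV[R]_n) : \bar R :=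
  if A == set0 then 0 else
  if diam A <= e%:E
  then (ball_volume R m * (fine (diam A) / 2) ^+ m)%:E else +oo.

Definition hausdorff_outer (R : realType) (n m : nat) (A : set 'rV[R]_n) :
    \bar R :=
  ereal_sup [set cover_measure (hausdorff_gauge m e) A
            | e in [set e : R | (0 < e)%R]].

Lemma box_gauge0 (R : realType) (n : nat) :
  box_gauge (set0 : set 'rV[R]_n) = 0.
Proof. by rewrite /box_gauge eqxx. Qed.

Lemma box_gauge_ge0 (R : realType) (n : nat) (A : set 'rV[R]_n) :
  0 <= box_gauge A.
Proof.
rewrite /box_gauge; case: ifP => // _; apply: le_ereal_inf_tmp => _ [a [b [ab _ ->]]].
by rewrite lee_fin; apply: prodr_ge0 => i _; rewrite subr_ge0.
Qed.

Lemma diam_ge0 (R : realType) (n : nat) (A : set 'rV[R]_n) :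
  A !=set0 -> 0 <= diam A.
Proof.
move=> [x Ax]; apply: (@le_trans _ _ (enorm (x - x))%:E).
  by rewrite lee_fin sqrtr_ge0.
by apply: ereal_sup_ubound; exists x, x.
Qed.

Lemma ball_volume_ge0 (R : realType) (m : nat) : (0 <= ball_volume R m)%R.
Proof.
have [//] : ((0 <= ball_volume R m) /\ (0 <= ball_volume R m.+1))%R.
elim: m => [|m [h0 h1]] //; split => //=.
by rewrite mulr_ge0// divr_ge0// mulr_ge0// pi_ge0.
Qed.

Lemma hausdorff_gauge0 (R : realType) (n m : nat) (e : R) :
  hausdorff_gauge m e (set0 : set 'rV[R]_n) = 0.
Proof. by rewrite /hausdorff_gauge eqxx. Qed.

Lemma hausdorff_gauge_ge0 (R : realType) (n m : nat) (e : R)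
    (A : set 'rV[R]_n) : 0 <= hausdorff_gauge m e A.
Proof.
rewrite /hausdorff_gauge; case: eqP => // /eqP/set0P A0.
case: ifP => // _; rewrite lee_fin mulr_ge0 ?ball_volume_ge0//.
by rewrite exprn_ge0// divr_ge0// fine_ge0// diam_ge0.
Qed.

HB.instance Definition _ (R : realType) (n : nat) :=
  isOuterMeasure.Build R 'rV[R]_n (@lebesgue_outer R n)
    (@mu_ext0 _ (all_measurable 'rV[R]_n) R _ (@box_gauge0 R n)
       (@box_gauge_ge0 R n))
    (@mu_ext_ge0 _ (all_measurable 'rV[R]_n) R _ (@box_gauge_ge0 R n))
    (@le_mu_ext _ (all_measurable 'rV[R]_n) R _)
    (@mu_ext_sigma_subadditive _ (all_measurable 'rV[R]_n) R _
       (@box_gauge_ge0 R n)).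

Lemma cover_hausdorff_ge0 (R : realType) (n m : nat) (e : R)
    (A : set 'rV[R]_n) : 0 <= cover_measure (hausdorff_gauge m e) A.
Proof.
exact: (@mu_ext_ge0 _ (all_measurable 'rV[R]_n) R _
  (@hausdorff_gauge_ge0 R n m e)).
Qed.

Lemma hausdorff_outer0 (R : realType) (n m : nat) :
  hausdorff_outer m (set0 : set 'rV[R]_n) = 0.
Proof.
rewrite /hausdorff_outer (_ : image _ _ = [set 0]) ?ereal_sup1//.
apply/seteqP; split => [_ [e _ <-]|_ ->]; last exists 1%R => //=.
all: exact: (@mu_ext0 _ (all_measurable 'rV[R]_n) R _
  (@hausdorff_gauge0 R n m _) (@hausdorff_gauge_ge0 R n m _)).
Qed.

Lemma hausdorff_outer_ge0 (R : realType) (n m : nat) (A : set 'rV[R]_n) :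
  0 <= hausdorff_outer m A.
Proof.
apply: (le_trans (@cover_hausdorff_ge0 R n m 1 A)).
by apply: ereal_sup_ubound; exists 1%R => //=.
Qed.

Lemma le_hausdorff_outer (R : realType) (n m : nat) :
  {homo @hausdorff_outer R n m : A B / A `<=` B >-> A <= B}.
Proof.
move=> A B AB; apply: ge_ereal_sup => _ [e e0 <-].
apply: (@le_trans _ _ (cover_measure (hausdorff_gauge m e) B)).
  exact: (@le_mu_ext _ (all_measurable 'rV[R]_n)).
by apply: ereal_sup_ubound; exists e.
Qed.

Lemma hausdorff_outer_sigma_subadditive (R : realType) (n m : nat) :
  sigma_subadditive (@hausdorff_outer R n m).
Proof.
move=> F; apply: ge_ereal_sup => _ [e e0 <-].
apply: le_trans.
  exact: (@mu_ext_sigma_subadditive _ (all_measurable 'rV[R]_n) R _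
    (@hausdorff_gauge_ge0 R n m e)).
apply: lee_nneseries => [i _ _|i _]; first exact: cover_hausdorff_ge0.
by apply: ereal_sup_ubound; exists e.
Qed.

HB.instance Definition _ (R : realType) (n m : nat) :=
  isOuterMeasure.Build R 'rV[R]_n (@hausdorff_outer R n m)
    (@hausdorff_outer0 R n m) (@hausdorff_outer_ge0 R n m)
    (@le_hausdorff_outer R n m) (@hausdorff_outer_sigma_subadditive R n m).

End cover_measure.

Definition lebesgue_om (R : realType) (n : nat) :
    {outer_measure set 'rV[R]_n -> \bar R} := @lebesgue_outer R n.

Definition hausdorff_om (R : realType) (n m : nat) :
    {outer_measure set 'rV[R]_n -> \bar R} := @hausdorff_outer R n m.

(* 'rV[R]_n with its Lebesgue (not only Borel) sigma-algebra, respectively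
   with the Caratheodory sigma-algebra of the (n-1)-dimensional Hausdorff
   measure. *)
Definition leb_space (R : realType) (n : nat) :=
  caratheodory_type (lebesgue_om R n).
Definition surf_space (R : realType) (n : nat) :=
  caratheodory_type (hausdorff_om R n n.-1).

HB.instance Definition _ (R : realType) (n : nat) :=
  Measurable.on (leb_space R n).
HB.instance Definition _ (R : realType) (n : nat) :=
  Measurable.on (surf_space R n).

Definition leb (R : realType) (n : nat) :
    {measure set (leb_space R n) -> \bar R} :=
  lebesgue_om R n : set (caratheodory_type (lebesgue_om R n)) -> \bar R.

(* The counting measure when n = 1. *)
Definition surf (R : realType) (n : nat) :
    {measure set (surf_space R n) -> \bar R} :=
  hausdorff_om R n n.-1 :
    set (caratheodory_type (hausdorff_om R n n.-1)) -> \bar R.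

Fixpoint Ck (R : realType) (m k : nat) (f : 'rV[R]_m -> R) : Prop :=
  continuous f /\
  match k with
  | 0 => True
  | k'.+1 => forall i : 'I_m,
      (forall x, derivable f x (delta_mx 0 i)) /\
      Ck k' (fun x => 'D_(delta_mx 0 i) f x)
  end.

(* Near each of its boundary points z, and up to relabelling and reorienting
   the coordinate axes, Omega is the strict epigraph of a C^infinity function
   of n - 1 variables; col' i x is x without its i-th coordinate. *)
Definition smooth_boundary (R : realType) (n : nat) (Omega : set 'rV[R]_n) :=
  forall z, boundary Omega z ->
    exists (i : 'I_n) (b : bool) (g : 'rV[R]_n.-1 -> R),
      (forall k, Ck k g) /\
      \forall x \near z, Omega x <-> g (col' i x) < (-1) ^+ b * x 0 i.

Definition smooth_bounded_domain (R : realType) (n : nat)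
    (Omega : set 'rV[R]_n) :=
  [/\ open Omega, connected Omega, Omega !=set0, bounded_set Omega &
      smooth_boundary Omega].

Definition compact_in (R : realType) (n : nat) (Omega K : set 'rV[R]_n) :=
  compact K /\ K `<=` Omega.

Definition comparable_on (R : realType) (T : Type) (D : set T)
    (f g : T -> R) :=
  exists2 C : R, 0 < C & forall t, D t -> C^-1 * g t <= f t <= C * g t.

Section kernels.
Context (R : realType) (n : nat) (Omega : set 'rV[R]_n).

Definition L1_bnd (h : 'rV[R]_n -> R) :=
  (surf R n).-integrable (boundary Omega) (EFin \o h).

Definition L1_loc (u : 'rV[R]_n -> R) :=
  forall K, compact_in Omega K -> (leb R n).-integrable K (EFin \o u).

Definition L1_weighted (gamma : R) (f : 'rV[R]_n -> R) :=
  measurable_fun (Omega : set (leb_space R n)) f /\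
  (leb R n).-integrable Omega (fun x => (f x * delta Omega x `^ gamma)%:E).

Definition Linfty (D : set 'rV[R]_n) (f : 'rV[R]_n -> R) :=
  measurable_fun (D : set (leb_space R n)) f /\
  exists M : R, forall x, D x -> `|f x| <= M.

Definition Linfty_c (f : 'rV[R]_n -> R) :=
  Linfty Omega f /\
  exists2 K, compact_in Omega K & forall x, Omega x -> ~ K x -> f x = 0.

(* For each K, weak convergence in L^1(K), whose dual is L^infty(K). *)
Definition weak_cvg_L1_loc (v_ : nat -> 'rV[R]_n -> R) (u : 'rV[R]_n -> R) :=
  [/\ forall j, L1_loc (v_ j), L1_loc u &
      forall K phi, compact_in Omega K -> Linfty K phi ->
        \int[leb R n]_(x in K) (v_ j x * phi x) @[j --> \oo] -->
        \int[leb R n]_(x in K) (u x * phi x)].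

(* G is only meant on Omega x Omega and its values on the diagonal are
   arbitrary reals.  Measurability is with respect to the product of the
   Lebesgue sigma-algebra with itself, so that every section G(x, .), which
   the Green operator integrates, is measurable. *)
Definition green_kernel (s gamma : R) (G : 'rV[R]_n -> 'rV[R]_n -> R) :=
  [/\ (0 < s <= 1) && (0 < gamma <= 1), 2 * s <= n%:R,
      measurable_fun
        (Omega `*` Omega : set (leb_space R n * leb_space R n)%type)
        (fun p => G p.1 p.2),
      forall x y, Omega x -> Omega y -> G x y = G y x &
      comparable_on [set p | [/\ Omega p.1, Omega p.2 & p.1 != p.2]]
        (fun p => G p.1 p.2)
        (fun p => (enorm (p.1 - p.2) `^ (n%:R - 2 * s))^-1 *
           (Num.min (delta Omega p.1 * delta Omega p.2 /
                     enorm (p.1 - p.2) ^+ 2) 1) `^ gamma)].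

Definition green_op (G : 'rV[R]_n -> 'rV[R]_n -> R) (f : 'rV[R]_n -> R)
    (x : 'rV[R]_n) : R :=
  \int[leb R n]_(y in Omega) (G x y * f y).

Definition normal_derivative_kernel (gamma : R)
    (G DG : 'rV[R]_n -> 'rV[R]_n -> R) :=
  measurable_fun
    (boundary Omega `*` Omega : set (surf_space R n * leb_space R n)%type)
    (fun p => DG p.1 p.2) /\
  forall (z : 'rV[R]_n) (x_ : nat -> 'rV[R]_n),
    boundary Omega z -> (forall j, Omega (x_ j)) -> x_ @ \oo --> z ->
    \forall y \ae leb R n, Omega y ->
      G (x_ j) y / delta Omega (x_ j) `^ gamma @[j --> \oo] --> DG z y.

Definition normal_derivative (gamma : R) (u : 'rV[R]_n -> R)
    (z : 'rV[R]_n) : R :=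
  lim (u x / delta Omega x `^ gamma @[x --> within Omega (nbhs z)]).

(* The integrals are extended-real valued, and the left-hand side is finite
   for u in L^1_loc: the right-hand side has to converge as well. *)
Definition weak_dual_solution (gamma : R) (G : 'rV[R]_n -> 'rV[R]_n -> R)
    (h u : 'rV[R]_n -> R) :=
  forall psi, Linfty_c psi ->
    (\int[leb R n]_(x in Omega) (u x * psi x)%:E =
     \int[surf R n]_(z in boundary Omega)
        (h z * normal_derivative gamma (green_op G psi) z)%:E)%E.

End kernels.

(* Main.v *)
(** Comparability of the kernel gives G(x,y)/delta(x)^gamma <= C
    delta(y)^(2s-n-gamma) as soon as |x-y| >= delta(y)/2.  By dominated
    convergence D_gamma[G(psi)](z) is then the integral of D_gamma G(z,.) psi,
    so Fubini's theorem turns the equation for u into the representation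
    formula, and the bound on the kernel passes to u.  Surface measure is not
    sigma-finite on the whole space, but it is on the support of an integrable
    h.  Uniqueness: test with a truncation of the difference of two solutions.

    For the approximation, cut the boundary into finitely many cells A_i of
    diameter less than 1/j, choose a ball B_i inside Omega close to A_i, and
    let f_j be the sum of (int_(A_i) h) 1_(B_i) / (|B_i| delta^gamma).  By the
    symmetry of G, testing G(f_j) with psi integrates h against the averages of
    G(psi)/delta^gamma over the B_i, and these tend to D_gamma[G(psi)]. *)

Require Import Defs.
From HB Require Import structures.
From mathcomp Require Import all_boot all_order all_algebra.
From mathcomp Require Import all_classical all_reals all_analysis.
From mathcomp Require Import measurable_realfun ess_sup_inf lra ring.

Set Implicit Arguments.
Unset Strict Implicit.
Unset Printing Implicit Defensive.

Import Order.TTheory GRing.Theory Num.Theory.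
Import numFieldNormedType.Exports.

Local Open Scope classical_set_scope.
Local Open Scope ring_scope.

(** * Outer measures *)

(** The Lebesgue and Hausdorff measures of the statement are bare outer measures, so measurability
    of open sets and the volume of boxes come first. Volumes are needed from both sides: upper
    bounds make the kernel integrable, and the lower bound gives the mollifying balls positive
    volume. The delicate point is the null sets. [DG z] is prescribed only almost everywhere, as a
    limit along sequences, with an exceptional set that depends on [z] and on the sequence. The
    solution is therefore built from [DG] truncated to the range allowed by the kernel bound. The
    truncation is jointly measurable and satisfies the bound at every point, so its integrals
    converge everywhere; a Fubini argument on the set where the two kernels differ recovers the
    formula with [DG] itself. Limits at the boundary are obtained by contradiction, along a sequence
    that violates them. The bounding weight blows up at the boundary. Only its product with a test
    function is bounded, because the support of the test function keeps a positive distance [d] from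
    the boundary. *)

Lemma outer_measureU (R : realType) (T : Type)
    (mu : {outer_measure set T -> \bar R}) (A B : set T) :
  (mu (A `|` B) <= mu A + mu B)%E.
Proof.
apply: le_trans (le_outer_measureIC mu A (A `|` B)) _.
by apply: leeD; apply: le_outer_measure => x; [case|case=> -[]].
Qed.

(* Caratheodory's criterion for metric outer measures, with the distance to
   the set replaced by an arbitrary separating function [g]. *)
Lemma caratheodory_separated (R : realType) (T : Type)
    (mu : {outer_measure set T -> \bar R}) (g : T -> R) :
  (forall (A B : set T) (e : R), 0 < e ->
     (forall a b, A a -> B b -> g a + e <= g b) ->
     (mu A + mu B <= mu (A `|` B))%E) ->
  mu.-caratheodory [set x | g x <= 0].
Proof.
move=> sep; apply: le_caratheodory_measurable => X; set F := [set x | _].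
have [Xoo|Xoo] := eqVneq (mu X) +oo%E; first by rewrite Xoo leey.
have invS (k : nat) : 0 < (k.+1%:R : R)^-1 by rewrite invr_gt0 ltr0n.
(* The sets [A k] exhaust the part of [X] outside [F], and [S k] is the shell between [A k] and
   [A k.+1]. *)
pose A k := X `&` [set x | k.+1%:R^-1 <= g x].
pose S k := X `&` [set x | k.+2%:R^-1 <= g x < k.+1%:R^-1].
have AX k : (mu (A k) <= mu X)%E by apply: le_outer_measure => x [].
have AS k : A k `|` S k.+1 `<=` A k.+2.
  move=> x [] [Xx /=] => [h|/andP[h _]]; split => //=.
  by apply: le_trans h; rewrite lef_pV2 ?posrE ?ltr0n// ler_nat ltnW// ltnW.
(* Adjacent shells touch, but [A k] and [S k.+1] are separated, so the shells of one parity add up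
   inside an [A]. The two terms on the right account for the two parities, and the series of all
   shells is at most twice [mu X]. *)
have sum_le k : (\sum_(0 <= i < k.+1) mu (S i) <= mu (A k.+1) + mu (A k))%E.
  elim: k => [|k IH].
    rewrite big_nat1; apply: (@le_trans _ _ (mu (A 1%N))); last by rewrite leeDl ?outer_measure_ge0.
    by apply: le_outer_measure => x [Xx /= /andP[h _]]; split.
  rewrite big_nat_recr//=; apply: le_trans (leeD2r _ IH) _.
  rewrite -addeA addeC leeD2r//.
  apply: le_trans (le_outer_measure mu _ _ (@AS k)).
  rewrite addeC setUC; apply: (@sep _ _ (k.+1%:R^-1 - k.+2%:R^-1) _ _).
    by rewrite subr_gt0 ltf_pV2 ?posrE ?ltr0n// ltr_nat.
  move=> a b [_ /andP[_ /= ha]] [_ /= hb].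
  by apply: le_trans hb; rewrite addrCA -lerBrDl subrr subr_le0 ltW.
have Xfin : mu X \is a fin_num by rewrite ge0_fin_numE ?outer_measure_ge0// ltey.
have sfin : (\sum_(0 <= i <oo) mu (S i) < +oo)%E.
  apply: (@le_lt_trans _ _ (mu X + mu X)%E); last first.
    by rewrite -ge0_fin_numE ?adde_ge0 ?outer_measure_ge0// fin_numD Xfin.
  apply: lime_le; first by apply: is_cvg_nneseries => *; exact: outer_measure_ge0.
  exists 1%N => // -[|N] //= _; apply: le_trans (sum_le _) _; exact: leeD.
have tail := nneseries_tail_cvg sfin (fun k _ => outer_measure_ge0 mu (S k)).
have cover k : X `&` ~` F `<=`
    A k `|` \bigcup_i (if (k <= i)%N then S i else set0).
  move=> x [Xx /= /negP]; rewrite -ltNge => gx0.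
  have [h|h] := leP k.+1%:R^-1 (g x); first by left; split.
  right; have ex : exists m, (m.+1%:R : R)^-1 <= g x.
    exists (Num.truncn (g x)^-1); rewrite -[leRHS]invrK lef_pV2 ?posrE ?ltr0n ?invr_gt0//.
    by apply/ltW/truncnS_gt.
  have := ex_minnP ex => -[m hm hmin].
  have km : (k < m)%N.
    rewrite ltnNge; apply/negP => mk; move: (le_lt_trans hm h).
    by rewrite ltNge lef_pV2 ?posrE ?ltr0n// ler_nat ltnS mk.
  case: m hm hmin km => // m hm hmin km; exists m => //.
  rewrite -ltnS km; split => //=; rewrite hm/= ltNge; apply/negP => /hmin.
  by rewrite ltnn.
apply/lee_addgt0Pr => e e0.
have [k hk] : exists k, (\sum_(k <= i <oo) mu (S i) <= e%:E)%E.
  have h0 : (0 < e%:E)%E by rewrite lte_fin.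
  have [k _ /(_ k (leqnn _))/= /ltW ?] := tail _ (open_ereal_lt' h0).
  by exists k.
apply: (@le_trans _ _ (mu (X `&` F) + (mu (A k) + e%:E))%E).
  apply: leeD2l; apply: le_trans (le_outer_measure mu _ _ (cover k)) _.
  apply: le_trans (outer_measureU _ _ _) _; apply: leeD2l.
  apply: le_trans (outer_measure_sigma_subadditive mu _) _.
  apply: le_trans hk; rewrite [leRHS]eseries_cond [leRHS]eseries_mkcond.
  apply: lee_nneseries => [i _ _|i _]; first exact: outer_measure_ge0.
  by case: ifP => //=; rewrite outer_measure0.
rewrite addeA; apply: leeD2r.
(* [F] and [A k] are separated by [k.+1%:R^-1], as [g <= 0] on [F]. *)
apply: le_trans (sep _ _ _ (invS k) _) _.
  by move=> a b [_ /= ha] [_ /= hb]; apply: le_trans hb; rewrite gerDr.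
by apply: le_outer_measure => x [] [].
Qed.

(** An open set is the union of the half-open boxes with rational corners that it contains. They are
    countably many, and each is a Boolean combination of half-spaces. *)
Lemma open_measurable_halfspaces (R : realType) (n : nat)
    (mu : {outer_measure set 'rV[R]_n -> \bar R}) :
  (forall i c, mu.-caratheodory [set x : 'rV[R]_n | x 0 i <= c]) ->
  forall U : set 'rV[R]_n, open U -> measurable (U : set (caratheodory_type mu)).
Proof.
move=> half U oU.
pose H (p : 'rV[rat]_n * 'rV[rat]_n) (i : 'I_n) : set 'rV[R]_n :=
  [set x | x 0 i <= ratr (p.2 0 i)] `\` [set x | x 0 i <= ratr (p.1 0 i)].
pose Box p : set 'rV[R]_n := ~` \bigcup_i ~` H p i.
have mBox p : measurable (Box p : set (caratheodory_type mu)).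
  apply: measurableC; apply: countable_bigcupT_measurable => [|i].
    exact: countableP.
  by apply: measurableC; apply: measurableD; exact: half.
have BoxP p x : Box p x <-> forall i, ratr (p.1 0 i) < x 0 i <= ratr (p.2 0 i).
  rewrite /Box setC_bigcup; split => [h i|h i _].
    have := h i I; rewrite setCK => -[/= -> /negP].
    by rewrite -ltNge andbT.
  rewrite setCK; have /andP[h1 h2] := h i.
  by split => //=; apply/negP; rewrite -ltNge.
rewrite (_ : U = \bigcup_p (if `[< Box p `<=` U >] then Box p else set0)).
  apply: (@countable_bigcupT_measurable _ (caratheodory_type mu)) => [|p]; first exact: countableP.
  by case: ifP.
apply/seteqP; split => [x Ux|x [p _]]; last by case: ifPn => // /asboolP; apply.
have /nbhs_ballP[e /= e0 eU] : nbhs x U by exact: open_nbhs_nbhs.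
have [a ha] : {a : 'I_n -> rat & forall i, x 0 i - e < ratr (a i) < x 0 i}.
  apply: (@choice _ _ (fun i q => x 0 i - e < ratr q < x 0 i)) => i.
  have [|q] := @rat_in_itvoo R (x 0 i - e) (x 0 i); first by rewrite ltrBlDr ltrDl.
  by rewrite in_itv; exists q.
have [b hb] : {b : 'I_n -> rat & forall i, x 0 i < ratr (b i) < x 0 i + e}.
  apply: (@choice _ _ (fun i q => x 0 i < ratr q < x 0 i + e)) => i.
  have [|q] := @rat_in_itvoo R (x 0 i) (x 0 i + e); first by rewrite ltrDl.
  by rewrite in_itv; exists q.
exists (\row_i a i, \row_i b i) => //; case: ifPn => [_|/asboolP[]].
  apply/BoxP => i /=; rewrite !mxE.
  by have /andP[_ ->] := ha i; have /andP[/ltW] := hb i.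
move=> y /BoxP hy; apply: eU; split => // j i; rewrite ord1 /ball/= ltr_norml.
have := hy i; have := ha i; have := hb i; rewrite /= !mxE; lra.
Qed.

Section cover_measures.
Context (R : realType) (T : pointedType).
Implicit Types (c : set T -> \bar R) (A : set T).
Local Open Scope ereal_scope.

Lemma cover_measure_le_series c A (F : nat -> set T) :
  A `<=` \bigcup_k F k -> cover_measure c A <= \sum_(k <oo) c (F k).
Proof. by move=> AF; apply: ereal_inf_lbound; exists F. Qed.

Lemma le_cover_measure c A (m : \bar R) :
  (forall F : nat -> set T, A `<=` \bigcup_k F k -> m <= \sum_(k <oo) c (F k)) ->
  m <= cover_measure c A.
Proof. by move=> h; apply: le_ereal_inf_tmp => _ [F [_ AF] <-]; exact: h. Qed.

Lemma cover_measure_le c A : c set0 = 0 -> (forall B, 0 <= c B) ->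
  cover_measure c A <= c A.
Proof.
move=> c0 cge0; pose F k := if k is 0%N then A else set0.
apply: (@le_trans _ _ (\sum_(k <oo) c (F k))).
  by apply: cover_measure_le_series => x Ax; exists 0%N.
rewrite (@nneseries_split _ _ 0 1)// add0n big_nat1 eseries0 ?adde0//.
by case=> // k _ _.
Qed.

(* The inequality passes from the gauge to the outer measure that it
   generates, one covering set at a time. *)
Lemma cover_measure_split c A B X : (forall C, 0 <= c C) ->
  (forall C, c (C `&` A) + c (C `&` B) <= c C) ->
  cover_measure c (X `&` A) + cover_measure c (X `&` B) <= cover_measure c X.
Proof.
move=> cge0 hc; apply: le_cover_measure => F XF.
apply: (@le_trans _ _
    (\sum_(k <oo) (c (F k `&` A)) + \sum_(k <oo) (c (F k `&` B)))).
  by apply: leeD; apply: cover_measure_le_series => x [/XF[k _ Fx] Ax]; exists k.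
rewrite -nneseriesD//; apply: lee_nneseries => // k _ _.
by rewrite adde_ge0.
Qed.

End cover_measures.

Lemma coord_le_enorm (R : realType) (n : nat) (v : 'rV[R]_n) i :
  `|v 0 i| <= enorm v.
Proof.
rewrite -sqrtr_sqr ler_wsqrtr// (bigD1 i)//= lerDl.
by apply: sumr_ge0 => j _; exact: sqr_ge0.
Qed.

(** * Half-spaces and the Hausdorff measures *)

Section hausdorff_halfspace.
Context (R : realType) (n m : nat).
Implicit Types (A B : set 'rV[R]_n) (e : R).
Local Open Scope ereal_scope.

Lemma le_diam A B : A `<=` B -> diam A <= diam B.
Proof.
move=> AB; apply: ge_ereal_sup => _ [x [y [Ax Ay ->]]].
by apply: ereal_sup_ubound; exists x, y; split=> //; exact: AB.
Qed.

Lemma le_hausdorff_gauge e A B :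
  A `<=` B -> hausdorff_gauge m e A <= hausdorff_gauge m e B.
Proof.
move=> AB; rewrite {1}/hausdorff_gauge; case: eqP => [_|/eqP A0].
  exact: hausdorff_gauge_ge0.
have /set0P A0' := A0.
have B0 : B != set0 by apply/set0P; case: A0' => x /AB ?; exists x.
rewrite /hausdorff_gauge (negbTE B0); case: (leP (diam B)) => [Be|_]; last exact: leey.
have Ae := le_trans (le_diam AB) Be; rewrite Ae lee_fin.
apply: ler_wpM2l; first exact: ball_volume_ge0.
have dA := diam_ge0 A0'; have dAB := le_diam AB.
have fB : diam B \is a fin_num.
  by rewrite ge0_fin_numE ?(le_lt_trans Be) ?ltry// (le_trans dA).
have fA : diam A \is a fin_num.
  by rewrite ge0_fin_numE// (le_lt_trans Ae) ?ltry.
by rewrite lerXn2r ?nnegrE ?divr_ge0 ?fine_ge0 ?(le_trans dA)// ler_pM2r ?fine_le.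
Qed.

Lemma hausdorff_gauge_antitone e e' A :
  (e <= e')%R -> hausdorff_gauge m e' A <= hausdorff_gauge m e A.
Proof.
move=> ee'; rewrite /hausdorff_gauge; case: ifP => // _.
case: (leP (diam A) e%:E) => [Ae|_]; last exact: leey.
by rewrite (le_trans Ae)// lee_fin.
Qed.

(** Serves the two suprema over scales in [hausdorff_outer], which are approached independently of
    each other. A finite [M] makes all quantities finite, so that they can be subtracted. *)
Lemma ereal_supD_le (S1 S2 : set (\bar R)) (M : \bar R) :
  S1 !=set0 -> S2 !=set0 -> (forall s, S1 s -> 0 <= s) ->
  (forall s, S2 s -> 0 <= s) ->
  (forall s t, S1 s -> S2 t -> s + t <= M) ->
  ereal_sup S1 + ereal_sup S2 <= M.
Proof.
move=> [s0 S1s0] [t0 S2t0] S1ge S2ge h.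
have [->|Moo] := eqVneq M +oo; first by rewrite leey.
have fin s : 0 <= s -> s <= M -> s \is a fin_num.
  by move=> s1 s2; rewrite ge0_fin_numE// (le_lt_trans s2)// ltey.
have le2 t : S2 t -> t <= M.
  by move=> S2t; apply: le_trans (h _ _ S1s0 S2t); rewrite leeDr// S1ge.
have sup2 : ereal_sup S2 \is a fin_num.
  apply: fin; first by apply: le_trans (ereal_sup_ubound S2t0); exact: S2ge.
  by apply: ge_ereal_sup.
rewrite -leeBrDr//; apply: ge_ereal_sup => s S1s.
rewrite leeBrDr// addeC.
have sfin : s \is a fin_num.
  apply: fin; first exact: S1ge.
  by apply: le_trans (h _ _ S1s S2t0); rewrite leeDl// S2ge.
rewrite -leeBrDr//; apply: ge_ereal_sup => t S2t.
by rewrite leeBrDr// addeC; exact: h.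
Qed.

(** A covering set of diameter below [e] cannot meet both [A] and [B], so the gauge splits along the
    cover. Since the gauge grows as the scale shrinks, one scale [d] below [d1], [d2] and [e] serves
    for both sides. *)
Lemma hausdorff_separated i A B e : (0 < e)%R ->
  (forall a b, A a -> B b -> (a 0 i + e <= b 0 i)%R) ->
  hausdorff_outer m A + hausdorff_outer m B <= hausdorff_outer m (A `|` B).
Proof.
move=> e0 sep; pose mu d := cover_measure (@hausdorff_gauge R n m d).
have mu_anti d d' X : (d <= d')%R -> mu d' X <= mu d X.
  move=> dd'; apply: le_cover_measure => F XF.
  apply: le_trans (cover_measure_le_series _ XF) _.
  apply: lee_nneseries => [k _ _|k _]; first exact: hausdorff_gauge_ge0.
  exact: hausdorff_gauge_antitone.
apply: ereal_supD_le.
- by exists (mu 1%R A); exists 1%R => //=.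
- by exists (mu 1%R B); exists 1%R => //=.
- by move=> _ [d _ <-]; exact: cover_hausdorff_ge0.
- by move=> _ [d _ <-]; exact: cover_hausdorff_ge0.
move=> _ _ [d1 /= d10 <-] [d2 /= d20 <-].
pose d : R := Num.min (Num.min d1 d2) (e / 2)%R.
have d0 : (0 < d)%R by rewrite !lt_min d10 d20 divr_gt0.
have de : (d < e)%R by rewrite !gt_min; apply/orP; right; lra.
apply: (@le_trans _ _ (mu d (A `|` B))); last first.
  by apply: ereal_sup_ubound; exists d.
apply: (@le_trans _ _ (mu d A + mu d B)).
  by apply: leeD; apply: mu_anti; rewrite !ge_min lexx ?orbT.
have EA : (A `|` B) `&` A = A by apply: setIidr => x; left.
have EB : (A `|` B) `&` B = B by apply: setIidr => x; right.
rewrite -{1}EA -{2}EB; apply: cover_measure_split => [C|C]; first exact: hausdorff_gauge_ge0.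
have [Cd|Cd] := leP (diam C) d%:E; last first.
  rewrite [leRHS]/hausdorff_gauge; case: eqP => [->|_].
    by rewrite !set0I !hausdorff_gauge0 adde0.
  by rewrite (lt_geF Cd) leey.
have [[x [Cx Ax]]|/set0P/negP/negPn/eqP ->] := pselect (C `&` A !=set0); last first.
  by rewrite hausdorff_gauge0 add0e le_hausdorff_gauge.
have -> : C `&` B = set0.
  rewrite -subset0 => y [Cy By].
  have : diam C < e%:E by apply: le_lt_trans Cd _; rewrite lte_fin.
  rewrite ltNge => /negP; apply.
  apply: (@le_trans _ _ (enorm (y - x))%:E); last first.
    by apply: ereal_sup_ubound; exists y, x.
  rewrite lee_fin; apply: le_trans (coord_le_enorm _ i).
  rewrite !mxE; have := sep _ _ Ax By => h.
  by apply: le_trans (ler_norm _); lra.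
by rewrite hausdorff_gauge0 adde0 le_hausdorff_gauge.
Qed.

Lemma hausdorff_open_measurable (U : set 'rV[R]_n) : open U ->
  measurable (U : set (caratheodory_type (hausdorff_om R n m))).
Proof.
apply: open_measurable_halfspaces => i c.
have -> : [set x : 'rV[R]_n | (x 0 i <= c)%R] = [set x | (x 0 i - c <= 0)%R].
  by apply/seteqP; split => x /=; rewrite subr_le0.
apply: caratheodory_separated => A B e e0 sep.
apply: (hausdorff_separated e0) => a b Aa Bb.
have := sep _ _ Aa Bb; lra.
Qed.

End hausdorff_halfspace.

(** * Lebesgue measure of boxes *)

Definition rbox (R : realType) (n : nat) (a b : 'rV[R]_n) : set 'rV[R]_n :=
  [set x | forall i, a 0 i <= x 0 i <= b 0 i].

Lemma coord_le_norm (R : realType) (n : nat) (v : 'rV[R]_n) i :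
  `|v 0 i| <= `|v|.
Proof.
rewrite [leRHS]/Num.norm/= mx_normE -[leLHS]nngE num_le.
exact: (le_bigmax _ _ (ord0, i)).
Qed.

Section lebesgue_boxes.
Context (R : realType) (n : nat).
Implicit Types (a b x : 'rV[R]_n) (A : set 'rV[R]_n).
Local Open Scope ereal_scope.

Lemma box_gauge_le a b A : (forall i, a 0 i <= b 0 i)%R -> A `<=` rbox a b ->
  box_gauge A <= (\prod_(i < n) (b 0 i - a 0 i))%:E.
Proof.
move=> ab Aab; rewrite /box_gauge; case: ifP => _.
  by rewrite lee_fin; apply: prodr_ge0 => i _; rewrite subr_ge0.
by apply: ereal_inf_lbound; exists a, b.
Qed.

(** A hyperplane cuts an enclosing box into two boxes whose volumes add up. A point of [A] on either
    side ensures that [c] lies between the two faces; if one side is empty, the box is kept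
    whole. *)
Lemma box_gauge_halfspace i c A :
  box_gauge (A `&` [set x : 'rV[R]_n | (x 0 i <= c)%R]) +
  box_gauge (A `&` ~` [set x : 'rV[R]_n | (x 0 i <= c)%R]) <= box_gauge A.
Proof.
set H := [set x : 'rV[R]_n | _].
rewrite [leRHS]/box_gauge; case: eqP => [->|_].
  by rewrite !set0I box_gauge0 adde0.
apply: le_ereal_inf_tmp => _ [a [b [ab Aab ->]]].
have [AH0|/set0P[x [Ax xc]]] := eqVneq (A `&` H) set0.
  by rewrite AH0 box_gauge0 add0e; apply: box_gauge_le => // x [/Aab].
have [AH0|/set0P[y [Ay /= /negP yc]]] := eqVneq (A `&` ~` H) set0.
  by rewrite AH0 box_gauge0 adde0; apply: box_gauge_le => // ? [/Aab].
have /andP[ax _] := Aab _ Ax i; have /andP[_ yb] := Aab _ Ay i.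
rewrite -ltNge in yc.
have ac : (a 0 i <= c)%R by exact: le_trans ax xc.
have cb : (c <= b 0 i)%R by apply: ltW; exact: lt_le_trans yc yb.
pose b' := \row_j (if j == i then c else b 0 j)%R.
pose a' := \row_j (if j == i then c else a 0 j)%R.
apply: (@le_trans _ _ ((\prod_(j < n) (b' 0 j - a 0 j))%:E +
                       (\prod_(j < n) (b 0 j - a' 0 j))%:E)).
  apply: leeD; apply: box_gauge_le => [j|z [Az zc] j].
  - by rewrite mxE; case: eqP => // ->.
  - rewrite mxE; have /andP[h1 h2] := Aab _ Az j.
    by case: eqP => [ji|_]; rewrite h1//= ji.
  - by rewrite mxE; case: eqP => // ->.
  - rewrite mxE; have /andP[h1 h2] := Aab _ Az j; move: zc => /= /negP.
    by case: eqP => [ji|_]; rewrite h2 andbT// ji -ltNge => /ltW.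
rewrite -EFinD lee_fin (bigD1 i)//= [X in (_ + X <= _)%R](bigD1 i)//=.
rewrite [leRHS](bigD1 i)//= !mxE eqxx.
have -> : (\prod_(j < n | j != i) (b' 0 j - a 0 j) =
           \prod_(j < n | j != i) (b 0 j - a 0 j))%R.
  by apply: eq_bigr => j /negbTE ji; rewrite mxE ji.
have -> : (\prod_(j < n | j != i) (b 0 j - a' 0 j) =
           \prod_(j < n | j != i) (b 0 j - a 0 j))%R.
  by apply: eq_bigr => j /negbTE ji; rewrite mxE ji.
by rewrite -mulrDl addrC subrKA.
Qed.

(** Cutting never increases the total box gauge, so half-spaces satisfy the Caratheodory condition
    directly, without the separating gap of the Hausdorff case. *)
Lemma lebesgue_open_measurable (U : set 'rV[R]_n) : open U ->
  measurable (U : set (leb_space R n)).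
Proof.
apply: open_measurable_halfspaces => i c.
apply: le_caratheodory_measurable => X; apply: cover_measure_split.
  exact: box_gauge_ge0.
exact: box_gauge_halfspace.
Qed.

Lemma lebesgue_closed_measurable (U : set 'rV[R]_n) : closed U ->
  measurable (U : set (leb_space R n)).
Proof.
move=> cU; rewrite -(setCK U); apply: measurableC.
by apply: lebesgue_open_measurable; exact: closed_openC.
Qed.

Lemma leb_rbox_le a b : (forall i, a 0 i <= b 0 i)%R ->
  leb R n (rbox a b) <= (\prod_(i < n) (b 0 i - a 0 i))%:E.
Proof.
move=> ab; apply: (@le_trans _ _ (box_gauge (rbox a b))).
  by apply: cover_measure_le; [exact: box_gauge0|exact: box_gauge_ge0].
exact: box_gauge_le.
Qed.

Lemma closed_rbox a b : closed (rbox a b).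
Proof.
rewrite (_ : rbox a b = \bigcap_(i in setT)
    ((fun x : 'rV[R]_n => x 0%R i) @^-1` `[a 0%R i, b 0%R i]%classic)).
  apply: closed_bigI => i _; apply: closed_comp; last exact: itv_closed.
  by move=> x _; exact: coord_continuous.
apply/seteqP; split => x /= h i; first by move=> _; rewrite /= in_itv /=.
by have := h i I; rewrite /= in_itv.
Qed.

Lemma measurable_rbox a b : measurable (rbox a b : set (leb_space R n)).
Proof. exact/lebesgue_closed_measurable/closed_rbox. Qed.

Lemma bounded_sub_rbox A : bounded_set A -> exists2 M : R, (0 < M)%R &
  A `<=` rbox (const_mx (- M)%R) (const_mx M).
Proof.
case=> M [_ hM]; exists (`|M| + 1)%R; first by rewrite ltr_wpDl.
move=> x Ax i; rewrite !mxE -ler_norml.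
apply: le_trans (hM (`|M| + 1)%R _ _ Ax); last by rewrite (le_lt_trans (ler_norm M))// ltrDl.
exact: coord_le_norm.
Qed.

Lemma leb_bounded_ltoo A : measurable (A : set (leb_space R n)) ->
  bounded_set A -> leb R n A < +oo.
Proof.
move=> mA /bounded_sub_rbox[M M0 AM].
have mM := measurable_rbox (const_mx (- M)%R) (const_mx M).
have leAM : leb R n A <= leb R n (rbox (const_mx (- M)%R) (const_mx M)).
  by apply: le_measure => //; rewrite inE.
apply: le_lt_trans leAM (le_lt_trans (leb_rbox_le _) (ltry _)).
by move=> i; rewrite !mxE; lra.
Qed.

End lebesgue_boxes.

Section lebesgue_sigma_finite.
Context (R : realType) (n : nat).

Lemma leb_sigma_finite : sigma_finite setT (leb R n).
Proof.
exists (fun k => rbox (const_mx (- k%:R)) (const_mx k%:R)) => [|k].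
  apply/seteqP; split => // x _; exists (Num.truncn `|x|).+1 => // i.
  rewrite !mxE -ler_norml; apply: le_trans (coord_le_norm _ _) _.
  exact/ltW/truncnS_gt.
split; first exact: measurable_rbox.
apply: le_lt_trans (leb_rbox_le _) (ltry _) => i; rewrite !mxE.
by apply: (@le_trans _ _ 0); rewrite ?oppr_le0.
Qed.

End lebesgue_sigma_finite.

(** * Lower bound for the volume of a box *)

Section lebesgue_lower_bound.
Context (R : realType).
Implicit Types (a b : nat -> nat -> R) (c : nat -> R) (lo hi x : nat -> R).

(* Integrating a weighted cover over the last coordinate turns it into a cover
   in one dimension less. *)
Lemma box_cover_series n lo hi a b c :
  (forall i, lo i <= hi i) -> (forall k i, a k i <= b k i) ->
  (forall k, 0 <= c k) ->
  (forall x, (forall i, (i < n)%N -> lo i <= x i <= hi i) ->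
     (1 <= \sum_(k <oo)
       (c k * \prod_(i < n) (a k i <= x i <= b k i)%R%:R)%:E)%E) ->
  ((\prod_(i < n) (hi i - lo i))%:E <=
     \sum_(k <oo) (c k * \prod_(i < n) (b k i - a k i))%:E)%E.
Proof.
move=> lohi ab; elim: n c => [|n IH] c c0 cover.
  rewrite big_ord0; have := cover (fun=> 0) (fun i => ltac:(by [])).
  by under eq_eseriesr do rewrite big_ord0; under [X in _ -> (_ <= X)%E]eq_eseriesr do rewrite big_ord0.
pose P k := \prod_(i < n) (b k i - a k i).
have P0 k : 0 <= P k by apply: prodr_ge0 => i _; rewrite subr_ge0.
pose V := \prod_(i < n) (hi i - lo i).
have V0 : 0 <= V by apply: prodr_ge0 => i _; rewrite subr_ge0.
pose f k (t : R) : \bar R := (c k * P k * (a k n <= t <= b k n)%R%:R)%:E.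
have fE k t : f k t = ((c k * P k)%:E * (\1_`[a k n, b k n] t)%:E)%E.
  rewrite /f indicE -EFinM; congr (_ * _%:R)%:E.
  by rewrite [RHS](_ : _ = `[< t \in `[a k n, b k n] >] :> nat)// asboolb in_itv.
have slice t : lo n <= t <= hi n -> (V%:E <= \sum_(k <oo) f k t)%E.
  move=> ht.
  (* Freezing the last coordinate at [t] moves its indicator into the weights; this is why the
     induction carries arbitrary weights [c]. *)
  have /= := IH (fun k => c k * (a k n <= t <= b k n)%R%:R).
  move=> H; apply: le_trans (H _ _) _ => [k|x hx|]; first by rewrite mulr_ge0.
    clear H; pose x' i := if (i < n)%N then x i else t.
    apply: le_trans (cover x' _) _ => [i|].
      rewrite ltnS leq_eqVlt /x' => /orP[/eqP ->|il]; first by rewrite ltnn.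
      by rewrite il; exact: hx.
    apply: lee_nneseries => [k _ _|k _]; first by rewrite lee_fin mulr_ge0// prodr_ge0.
    rewrite lee_fin big_ord_recr/= -mulrA ler_wpM2l// mulrC /x' ltnn.
    rewrite le_eqVlt; apply/orP; left; apply/eqP; congr (_ * _).
    by apply: eq_bigr => i _; rewrite ltn_ord.
  by under eq_eseriesr do rewrite mulrAC.
rewrite big_ord_recr/= -/V.
have mf k : measurable_fun `[lo n, hi n]%classic (f k).
  apply/measurable_EFinP; apply: (eq_measurable_fun (fun t => c k * P k * \1_`[a k n, b k n] t)).
    by move=> t _; have := fE k t; rewrite -EFinM => -[].
  by apply: measurable_funM => //; exact: measurable_indic.
have f0 k t : `[lo n, hi n]%classic t -> (0 <= f k t)%E.
  by move=> _; rewrite lee_fin !mulr_ge0.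
apply: (@le_trans _ _ (\int[lebesgue_measure]_(t in `[lo n, hi n]) V%:E)%E).
  rewrite integral_cst//= lebesgue_measure_itv/= lte_fin.
  case: ltP => h; first by rewrite -EFinD EFinM.
  have -> : hi n = lo n by apply/eqP; rewrite eq_le h lohi.
  by rewrite subrr mulr0 mule0.
apply: (@le_trans _ _ (\int[lebesgue_measure]_(t in `[lo n, hi n])
    \sum_(k <oo) f k t)%E).
  apply: ge0_le_integral => //.
  apply: (@ge0_emeasurable_sum _ _ _ `[lo n, hi n]%classic f xpredT) => [k t ht _|k _]; [exact: f0|exact: mf].
rewrite integral_nneseries//; apply: lee_nneseries => [k _ _|k _].
  by apply: integral_ge0 => t; exact: f0.
under eq_integral do rewrite fE.
rewrite ge0_integralZl//; last 2 first.
- by apply/measurable_EFinP; exact: measurable_indic.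
- by rewrite lee_fin mulr_ge0.
rewrite integral_indic// big_ord_recr/= mulrA -/(P k) [leRHS]EFinM.
apply: lee_wpmul2l; first by rewrite lee_fin mulr_ge0.
apply: (@le_trans _ _ (lebesgue_measure `[a k n, b k n]%classic)).
  by apply: le_measure => //; rewrite ?inE//; exact: measurableI.
rewrite lebesgue_measure_itv/= lte_fin; case: ltP => h; first by rewrite -EFinD.
by rewrite lee_fin subr_ge0.
Qed.

(** Each set of a cover is enlarged to a box whose volume exceeds its gauge by at most
    [e / 2 ^ k.+1]. The indicators of these boxes sum to at least 1 on the target box, which is the
    hypothesis of [box_cover_series]. *)
Lemma leb_rbox_ge n (lo hi : 'rV[R]_n) : (forall i, lo 0 i <= hi 0 i) ->
  ((\prod_(i < n) (hi 0 i - lo 0 i))%:E <= leb R n (rbox lo hi))%E.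
Proof.
move=> lohi; apply: le_cover_measure => F XF.
apply/lee_addgt0Pr => e e0; apply: le_trans (epsilon_trick _ _ (ltW e0)); last first.
  by move=> k; exact: box_gauge_ge0.
have [Soo|] := pselect (exists k, box_gauge (F k) = +oo%E).
  have [k Fk] := Soo; rewrite (@eseries_pinfty _ _ _ k) ?leey// => [i _|].
    by rewrite gt_eqF// (lt_le_trans (ltNyr 0))// adde_ge0 ?box_gauge_ge0// lee_fin divr_ge0 ?ltW.
  by rewrite Fk.
move=> /forallNP Fin.
pose Q k (ab : 'rV[R]_n * 'rV[R]_n) := [/\ (forall i, ab.1 0 i <= ab.2 0 i),
  F k `<=` rbox ab.1 ab.2 & F k !=set0 ->
  ((\prod_(i < n) (ab.2 0 i - ab.1 0 i))%:E <=
     box_gauge (F k) + (e / (2 ^ k.+1)%:R)%:E)%E].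
have [ab hab] : {ab & forall k, Q k (ab k)}.
  apply: (@choice _ _ Q) => k.
  have [F0|F0] := eqVneq (F k) set0.
    by exists (0, 0); split => //= [|[x]]; rewrite F0// => x.
  have ek : 0 < e / (2 ^ k.+1)%:R by rewrite divr_gt0// ltr0n expn_gt0.
  have : box_gauge (F k) \is a fin_num.
    by rewrite ge0_fin_numE ?box_gauge_ge0// ltey; apply/eqP/Fin.
  rewrite /box_gauge (negbTE F0) => /(lb_ereal_inf_adherent ek)[_ [a [b [ab Fab ->]]] /ltW h].
  by exists (a, b); split => //= _; rewrite /box_gauge (negbTE F0).
pose ext (v : 'rV[R]_n) (i : nat) : R := if insub i is Some j then v 0 j else 0.
have extE v (i : 'I_n) : ext v i = v 0 i.
  by rewrite /ext valK.
have ext_le (v w : 'rV[R]_n) : (forall i, v 0 i <= w 0 i) -> forall i, ext v i <= ext w i.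
  by move=> h i; rewrite /ext; case: insubP.
(* The weight 0 discards the empty sets of the cover: their gauge is 0, whereas the box [(0, 0)]
   chosen for them has volume 1 when [n = 0]. *)
have := @box_cover_series n (ext lo) (ext hi) (fun k => ext (ab k).1)
  (fun k => ext (ab k).2) (fun k => (F k != set0)%:R) (ext_le _ _ lohi)
  (fun k => ext_le _ _ (let: And3 h _ _ := hab k in h)) (fun k => ler0n _ _).
under eq_bigr do rewrite !extE.
move=> H; apply: le_trans (H _) _ => {H} [x hx|].
  pose y : 'rV[R]_n := \row_i x i.
  have [k _ Fky] : (\bigcup_k F k) y.
    by apply: XF => i; rewrite mxE -!extE; exact: hx.
  rewrite (@nneseriesD1 _ _ k xpredT)//; last by move=> j _; rewrite lee_fin mulr_ge0// prodr_ge0.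
  rewrite [X in (X + _)%E](_ : _ = 1%E).
    by rewrite leeDl// nneseries_ge0// => j _ _; rewrite lee_fin mulr_ge0// prodr_ge0.
  have -> : F k != set0 by apply/set0P; exists y.
  rewrite mul1r big1// => i _; have [_ Fab _] := hab k.
  by have := Fab _ Fky i; rewrite mxE !extE => ->.
apply: lee_nneseries => [k _ _|k _].
  rewrite lee_fin mulr_ge0// prodr_ge0// => i _; rewrite subr_ge0 !extE.
  by have [h _ _] := hab k.
under eq_bigr do rewrite !extE.
have [_ _ h] := hab k; have [F0|F0] := eqVneq (F k) set0.
  by rewrite mul0r adde_ge0 ?box_gauge_ge0// lee_fin divr_ge0 ?ltW.
by rewrite mul1r; apply: h; apply/set0P.
Qed.

End lebesgue_lower_bound.

(** * Euclidean distance and distance to the boundary *)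

Section euclidean_norm.
Context (R : realType) (n : nat).
Implicit Types x y v : 'rV[R]_n.

Lemma enorm_ge0 v : 0 <= enorm v. Proof. exact: sqrtr_ge0. Qed.

Lemma enorm_sqr v : enorm v ^+ 2 = \sum_(i < n) v 0 i ^+ 2.
Proof. by rewrite sqr_sqrtr// sumr_ge0// => i _; exact: sqr_ge0. Qed.

Lemma enormN v : enorm (- v) = enorm v.
Proof. by congr Num.sqrt; apply: eq_bigr => i _; rewrite mxE sqrrN. Qed.

Lemma enormB x y : enorm (x - y) = enorm (y - x).
Proof. by rewrite -enormN opprB. Qed.

Lemma cauchy_schwarz x y : \sum_(i < n) x 0 i * y 0 i <= enorm x * enorm y.
Proof.
have [y0|y0] := eqVneq (enorm y) 0.
  rewrite y0 mulr0 big1// => i _.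
  by have := coord_le_enorm y i; rewrite y0 normr_le0 => /eqP ->; rewrite mulr0.
have yp : 0 < enorm y by rewrite lt_neqAle eq_sym y0 enorm_ge0.
have [x0|x0] := eqVneq (enorm x) 0.
  rewrite x0 mul0r big1// => i _.
  by have := coord_le_enorm x i; rewrite x0 normr_le0 => /eqP ->; rewrite mul0r.
have xp : 0 < enorm x by rewrite lt_neqAle eq_sym x0 enorm_ge0.
(* [2 a b <= a^2 (|y| / |x|) + b^2 (|x| / |y|)] *)
have le2 i : x 0 i * y 0 i <= (x 0 i ^+ 2 * (enorm y / enorm x) +
                              y 0 i ^+ 2 * (enorm x / enorm y)) / 2.
  rewrite -subr_ge0 (_ : _ - _ = (x 0 i * enorm y - y 0 i * enorm x) ^+ 2 /
                                 (enorm x * enorm y) / 2); last by field; apply/andP.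
  by rewrite divr_ge0// divr_ge0 ?sqr_ge0// mulr_ge0 ?enorm_ge0.
apply: le_trans (ler_sum _ (fun i _ => le2 i)) _.
rewrite -mulr_suml big_split/= -!mulr_suml -!enorm_sqr.
by rewrite le_eqVlt; apply/orP; left; apply/eqP; field; apply/andP.
Qed.

Lemma enormD x y : enorm (x + y) <= enorm x + enorm y.
Proof.
rewrite -(ler_pXn2r (n := 2)) ?nnegrE ?addr_ge0 ?enorm_ge0//.
rewrite sqrrD !enorm_sqr.
under eq_bigr do rewrite mxE sqrrD -mulr_natr.
rewrite !big_split/= -mulr_suml -[in leRHS]mulr_natr lerD2r lerD2l ler_pM2r//.
exact: cauchy_schwarz.
Qed.

End euclidean_norm.

Lemma enorm_le_norm (R : realType) (n : nat) (v : 'rV[R]_n) :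
  enorm v <= n%:R * `|v|.
Proof.
rewrite -(ler_pXn2r (n := 2)) ?nnegrE ?mulr_ge0 ?enorm_ge0//.
rewrite enorm_sqr exprMn; apply: (@le_trans _ _ (n%:R * `|v| ^+ 2)).
  rewrite mulr_natl -[X in _ *+ X]card_ord -sumr_const; apply: ler_sum => i _.
  by rewrite -real_normK ?num_real// ler_pXn2r ?nnegrE ?normr_ge0// coord_le_norm.
rewrite ler_wpM2r ?sqr_ge0// expr2 -natrM ler_nat.
by case: n {v} => // n; rewrite leq_pmulr.
Qed.

Lemma norm_le_coord (R : realType) (n : nat) (v : 'rV[R]_n) M : 0 <= M ->
  (forall i, `|v 0 i| <= M) -> `|v| <= M.
Proof.
move=> M0 vM; rewrite [leLHS]/Num.norm/= mx_normE.
pose e := NngNum M0; rewrite -[leRHS]/(e%:num) num_le.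
apply/bigmax_leP; split=> [|[i j] _]; rewrite -num_le//=.
by rewrite (ord1 i).
Qed.

Lemma norm_le_enorm (R : realType) (n : nat) (v : 'rV[R]_n) : `|v| <= enorm v.
Proof.
by apply: norm_le_coord; [exact: enorm_ge0|exact: coord_le_enorm].
Qed.

Section domain_geometry.
Context (R : realType) (n : nat) (Omega : set 'rV[R]_n).
Hypotheses (Oopen : open Omega).
Implicit Types x y z : 'rV[R]_n.
Local Notation D := (boundary Omega).

Lemma boundary_notin z : D z -> ~ Omega z.
Proof. by case=> _; rewrite (proj1 (interior_id _) Oopen). Qed.

Lemma closed_boundary : closed D.
Proof.
rewrite /boundary setDE; apply: closedI; first exact: closed_closure.
by apply: open_closedC; exact: open_interior.
Qed.

Lemma bounded_boundary : bounded_set Omega -> bounded_set D.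
Proof.
move=> /bounded_sub_rbox[M M0 OM].
have cM : closure Omega `<=` rbox (const_mx (- M)) (const_mx M).
  by rewrite (proj1 (closure_id _) (@closed_rbox R n _ _)); exact: closureS.
exists M; split; first exact: num_real.
move=> N /ltW MN x [/cM h _]; apply: norm_le_coord => [|i].
  by rewrite (le_trans (ltW M0)).
by apply: le_trans MN; have := h i; rewrite !mxE ler_norml.
Qed.

Lemma compact_boundary : bounded_set Omega -> compact D.
Proof.
move=> Ob; apply: bounded_closed_compact; first exact: bounded_boundary.
exact: closed_boundary.
Qed.

(** Without boundary [Omega] would be clopen, and so would its preimage under the line through a
    point inside and a point outside, against the connectedness of the real line. A nonempty
    boundary keeps [delta] from being the infimum of the empty set. *)
Lemma boundary_nonempty : (0 < n)%N -> bounded_set Omega -> Omega !=set0 ->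
  D !=set0.
Proof.
move=> n0 /bounded_sub_rbox[M M0 OM] [x Ox]; apply/set0P/negP => /eqP D0.
have cO : closed Omega.
  move=> y cy; apply: contrapT => Oy; have : D y.
    by split=> //; rewrite (proj1 (interior_id _) Oopen).
  by rewrite D0.
pose y : 'rV[R]_n := const_mx (M + 1).
have nOy : ~ Omega y.
  by move=> /OM/(_ (Ordinal n0)); rewrite !mxE => /andP[_]; lra.
pose f (t : R) := x + t *: (y - x).
have cf : continuous f.
  move=> t; apply: cvgD; first exact: cvg_cst.
  by apply: cvgZr_tmp; exact: cvg_id.
have cR : connected [set: R] by apply/connected_intervalP.
have : f @^-1` Omega = setT.
  apply: cR.
  - by exists 0; rewrite /= /f scale0r addr0.
  - by exists (f @^-1` Omega); rewrite ?setTI//; apply: open_comp => // ? _; exact: cf.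
  - by exists (f @^-1` Omega); rewrite ?setTI//; apply: closed_comp => // ? _; exact: cf.
move=> fT; have : (f @^-1` Omega) 1 by rewrite fT.
by rewrite /preimage/= /f scale1r addrC subrK.
Qed.

Lemma set_dist_le (A B : set 'rV[R]_n) x y : A x -> B y ->
  set_dist A B <= enorm (x - y).
Proof.
move=> Ax By; apply: ge_inf; last by exists x, y.
by exists 0 => _ [? [? [_ _ ->]]]; exact: enorm_ge0.
Qed.

Lemma le_set_dist (A B : set 'rV[R]_n) r : A !=set0 -> B !=set0 ->
  (forall x y, A x -> B y -> r <= enorm (x - y)) -> r <= set_dist A B.
Proof.
move=> [x Ax] [y By] h; apply: lb_le_inf; first by exists (enorm (x - y)), x, y.
by move=> _ [? [? [? ? ->]]]; exact: h.
Qed.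

Lemma delta_le x z : D z -> delta Omega x <= enorm (x - z).
Proof. by move=> Dz; exact: set_dist_le. Qed.

Lemma delta_ge0 x : 0 <= delta Omega x.
Proof.
(* The infimum of the empty set is 0 by convention. *)
have [D0|/set0P D0] := eqVneq D set0.
  rewrite /delta /set_dist D0 (_ : mkset _ = set0) ?inf0//.
  by rewrite -subset0 => r [? [? []]].
by apply: le_set_dist => //; [exists x|move=> ? ? _ _; exact: enorm_ge0].
Qed.

Lemma delta_lipschitz x y : delta Omega x <= delta Omega y + enorm (x - y).
Proof.
have [D0|/set0P D0] := eqVneq D set0.
  have d0 w : delta Omega w = 0.
    rewrite /delta /set_dist D0 (_ : mkset _ = set0) ?inf0//.
    by rewrite -subset0 => r [? [? []]].
  by rewrite !d0 add0r enorm_ge0.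
rewrite -lerBlDr; apply: le_set_dist => //; first by exists y.
move=> _ z -> Dz; rewrite lerBlDr; apply: le_trans (delta_le _ Dz) _.
by rewrite -(subrKA y) addrC enormD.
Qed.

Lemma delta_continuous : continuous (delta Omega).
Proof.
move=> x; apply/(@cvgrPdist_lt _ _ _ (nbhs x) (nbhs_filter x)) => e e0.
apply/nbhs_ballP; exists (e / n.+1%:R); first by rewrite /= divr_gt0.
move=> y; rewrite -ball_normE /= ltr_pdivlMr ?ltr0n// => xye.
rewrite ltr_norml; have /= := delta_lipschitz x y; have := delta_lipschitz y x.
rewrite (enormB y x).
suff : enorm (x - y) < e by lra.
apply: le_lt_trans (enorm_le_norm _) _; apply: le_lt_trans xye.
by rewrite mulrC ler_wpM2l// ler_nat.
Qed.

Hypothesis (D0 : D !=set0).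

Lemma delta_gt0 x : Omega x -> 0 < delta Omega x.
Proof.
move=> Ox; have /nbhs_ballP[e /= e0 eO] : nbhs x Omega by exact: open_nbhs_nbhs.
apply: (lt_le_trans e0); apply: le_set_dist => //; first by exists x.
move=> _ z -> Dz; rewrite leNgt; apply/negP => h; apply: (boundary_notin Dz).
by apply: eO; rewrite -ball_normE/=; apply: le_lt_trans h; exact: norm_le_enorm.
Qed.

Lemma set_dist_gt0 K : K !=set0 -> compact_in Omega K -> 0 < set_dist K D.
Proof.
move=> K0 [cK KO].
have [|c cK' cmin] := @EVT_min_rV _ _ (delta Omega) K K0 cK.
  by apply: continuous_subspaceT => ?; exact: delta_continuous.
rewrite inE in cK'; apply: (lt_le_trans (delta_gt0 (KO _ cK'))).
apply: le_set_dist => // x z Kx Dz.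
by apply: le_trans (delta_le x Dz); apply: cmin; rewrite inE.
Qed.

Lemma set_dist_le_delta K x : K x -> set_dist K D <= delta Omega x.
Proof.
move=> Kx; apply: le_set_dist => //; first by exists x.
by move=> _ z -> Dz; exact: set_dist_le.
Qed.

End domain_geometry.

(** * Fubini theorem and kernel operators *)

Section sigma_finite_copy.
Context d (T : measurableType d) (R : realType).
Variables (m : {measure set T -> \bar R}) (sm : sigma_finite setT m).

(** Attaches a proof of sigma-finiteness to a measure as the structure that the Fubini theorems
    expect. The idle [let] keeps [sm] among the parameters, from which the instance below retrieves
    it. *)
Definition sigma_finite_copy : set T -> \bar R := let _ := sm in m.
HB.instance Definition _ := Measure.copy sigma_finite_copy m.
HB.instance Definition _ :=
  Measure_isSigmaFinite.Build _ _ _ sigma_finite_copy sm.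

End sigma_finite_copy.

Section fubini_on_rectangles.
Context d1 d2 (T1 : measurableType d1) (T2 : measurableType d2) (R : realType).
Variables (D1 : set T1) (D2 : set T2) (F : T1 -> T2 -> R).
Hypotheses (mD1 : measurable D1) (mD2 : measurable D2).
Hypothesis mF : measurable_fun (D1 `*` D2) (fun p => F p.1 p.2).
Local Open Scope ereal_scope.

(** Extension by zero: the Fubini theorems concern whole product spaces, while [F] is measurable
    only on the rectangle. *)
Let f : T1 * T2 -> \bar R := (fun p => (F p.1 p.2)%:E) \_ (D1 `*` D2).

Let mf : measurable_fun setT f.
Proof.
apply: (measurable_restrictT _ (measurableX mD1 mD2)).1.
by apply/measurable_EFinP; exact: mF.
Qed.

Lemma measurable_fun_slice1 x : D1 x -> measurable_fun D2 (F x).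
Proof.
move=> D1x; apply/measurable_EFinP; apply/(measurable_restrictT _ mD2).2.
rewrite (_ : _ \_ _ = f \o pair x); first exact: measurableT_comp.
apply/funext => y; rewrite /= /f !patchE in_setX/=.
by rewrite (mem_set D1x).
Qed.

Lemma measurable_fun_slice2 y : D2 y -> measurable_fun D1 (F ^~ y).
Proof.
move=> D2y; apply/measurable_EFinP; apply/(measurable_restrictT _ mD1).2.
rewrite (_ : _ \_ _ = f \o pair^~ y); first exact: measurableT_comp.
apply/funext => x; rewrite /= /f !patchE in_setX/=.
by rewrite (mem_set D2y) andbT.
Qed.

Variables (m1 : {measure set T1 -> \bar R}) (m2 : {measure set T2 -> \bar R}).

Let slice1 (g : \bar R -> \bar R) : g 0 = 0 ->
  (fun x => \int[m2]_y g (f (x, y))) =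
  (fun x => \int[m2]_(y in D2) g (F x y)%:E) \_ D1.
Proof.
move=> g0; apply/funext => x; rewrite patchE; case: ifPn => [xD|xD].
  rewrite [RHS]integral_mkcond; apply: eq_integral => y _.
  by rewrite /f !patchE in_setX/= xD/=; case: ifPn.
rewrite integral0_eq// => y _.
by rewrite /f patchE in_setX/= (negbTE xD) /= g0.
Qed.

Let slice2 (g : \bar R -> \bar R) : g 0 = 0 ->
  (fun y => \int[m1]_x g (f (x, y))) =
  (fun y => \int[m1]_(x in D1) g (F x y)%:E) \_ D2.
Proof.
move=> g0; apply/funext => y; rewrite patchE; case: ifPn => [yD|yD].
  rewrite [RHS]integral_mkcond; apply: eq_integral => x _.
  by rewrite /f !patchE in_setX/= yD andbT/=; case: ifPn.
rewrite integral0_eq// => x _.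
by rewrite /f patchE in_setX/= (negbTE yD) andbF /= g0.
Qed.

Hypotheses (s1 : sigma_finite setT m1) (s2 : sigma_finite setT m2).
Let M1 := sigma_finite_copy s1.
Let M2 := sigma_finite_copy s2.

Lemma rectangle_tonelli_measurable :
  measurable_fun D1 (fun x => \int[m2]_(y in D2) `|(F x y)%:E|).
Proof.
apply/(measurable_restrictT _ mD1).2; rewrite -(slice1 abse0).
apply: (@measurable_fun_fubini_tonelli_F _ _ _ _ _ M2 (abse \o f)) => //=.
exact: measurableT_comp.
Qed.

Hypothesis Ffin : \int[m1]_(x in D1) \int[m2]_(y in D2) `|(F x y)%:E| < +oo.

Let intf : (M1 \x M2)%E.-integrable setT f.
Proof.
apply/(integrable12ltyP _ _ mf).
rewrite (_ : (fun x => _) = (fun x => \int[m2]_(y in D2) `|(F x y)%:E|) \_ D1).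
  by rewrite -integral_mkcond.
exact: (slice1 abse0).
Qed.

Lemma rectangle_integrable1 :
  m1.-integrable D1 (fun x => \int[m2]_(y in D2) (F x y)%:E).
Proof.
apply/(integrable_mkcond _ mD1); rewrite -(slice1 (g := id))//.
exact: (integrable_fubini_F intf).
Qed.

Lemma rectangle_integrable2 :
  m2.-integrable D2 (fun y => \int[m1]_(x in D1) (F x y)%:E).
Proof.
apply/(integrable_mkcond _ mD2); rewrite -(slice2 (g := id))//.
apply/integrableP; split; first exact: (measurable_fubini_G intf).
have mf' : measurable_fun setT (abse \o f) by exact: measurableT_comp.
apply: le_lt_trans ((integrable21ltyP M1 M2 mf).1 intf).
apply: ge0_le_integral => //.
- by apply: measurableT_comp => //; exact: (measurable_fubini_G intf).
- by apply: (@measurable_fun_fubini_tonelli_G _ _ _ _ _ M1 _ mf') => /= p.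
- move=> y _; apply: le_abse_integral => //.
  exact: measurableT_comp.
Qed.

Lemma rectangle_fubini :
  \int[m1]_(x in D1) \int[m2]_(y in D2) (F x y)%:E =
  \int[m2]_(y in D2) \int[m1]_(x in D1) (F x y)%:E.
Proof.
rewrite integral_mkcond [RHS]integral_mkcond -(slice1 (g := id))//.
by rewrite -(slice2 (g := id))//; exact: (Fubini intf).
Qed.

End fubini_on_rectangles.

(** By Tonelli's theorem both families of sections integrate to the same value, here 0. This
    exchanges the quantifiers: a property valid for every [x] and almost every [y] holds, for almost
    every [y], at almost every [x]. *)
Lemma ae_ysection_null d1 d2 (T1 : measurableType d1) (T2 : measurableType d2)
    (R : realType) (m1 : {measure set T1 -> \bar R})
    (m2 : {measure set T2 -> \bar R}) (E : set (T1 * T2)) :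
  sigma_finite setT m1 -> sigma_finite setT m2 -> measurable E ->
  (forall x, m2 (xsection E x) = 0)%E ->
  {ae m2, forall y, m1 (ysection E y) = 0%E}.
Proof.
move=> s1 s2 mE E0; pose M1 := sigma_finite_copy s1; pose M2 := sigma_finite_copy s2.
have := indic_fubini_tonelli M1 M2 mE.
rewrite indic_fubini_tonelli_FE// indic_fubini_tonelli_GE//.
rewrite [LHS](_ : _ = 0%E); last by apply: integral0_eq => x _; exact: E0.
move=> /esym h.
have mG : measurable_fun setT (m1 \o ysection E).
  exact: (measurable_fun_ysection M1 mE).
have /ae_eq_integral_abs : (\int[m2]_y `|(m1 \o ysection E) y| = 0)%E.
  rewrite -[RHS]h; apply: eq_integral => y _; rewrite gee0_abs//.
by move=> /(_ measurableT mG); apply: filterS => y /(_ I).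
Qed.

Section integrable_support.
Context d (T : measurableType d) (R : realType) (mu : {measure set T -> \bar R}).
Variables (D : set T) (mD : measurable D) (h : T -> R).
Hypothesis ih : mu.-integrable D (EFin \o h).

Let A := D `&` [set z | h z != 0].

Let mh : measurable_fun D h.
Proof. by apply/measurable_EFinP; exact: measurable_int ih. Qed.

Let mA : measurable A.
Proof.
rewrite (_ : A = D `&` h @^-1` (~` [set 0])).
  by apply: mh => //; exact: measurableC.
by apply/seteqP; split => z [Dz /eqP].
Qed.

Let S k := D `&` [set z | k.+1%:R^-1 <= `|h z|].

Let mS k : measurable (S k).
Proof.
rewrite (_ : S k = D `&` (Num.norm \o h) @^-1` `[k.+1%:R^-1, +oo[%classic).
  by apply: (measurableT_comp _ mh) => //; exact: measurable_normr.
by apply/seteqP; split => z [Dz /=]; rewrite /S/= in_itv/= andbT.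
Qed.

(** Markov's inequality for [h]. *)
Let S_fin k : (mu (S k) < +oo)%E.
Proof.
have k0 : 0 < k.+1%:R^-1 :> R by rewrite invr_gt0 ltr0n.
have : ((k.+1%:R^-1)%:E * mu (S k) < +oo)%E.
  rewrite -integral_cst//; have /integrableP[_] := ih; apply: le_lt_trans.
  apply: (@le_trans _ _ (\int[mu]_(z in S k) `|(EFin \o h) z|)%E).
    apply: ge0_le_integral => //=.
    - by do 2 apply: measurableT_comp => //; apply: measurable_funS mh => // ? [].
    - by move=> z [_ /=]; rewrite lee_fin.
  apply: ge0_subset_integral => //; first by do 2 apply: measurableT_comp => //.
  by move=> z [].
rewrite -[X in (_ < X)%E -> _](@gt0_muley _ (k.+1%:R^-1)%:E) ?lte_fin//.
by rewrite lte_pmul2l ?lte_fin.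
Qed.

(* An integrable function lives on a sigma-finite set, to which the measure can
   be restricted; surface measure itself is not sigma-finite on the space. *)
Lemma integrable_sigma_finite_support :
  exists2 nu : {measure set T -> \bar R}, sigma_finite setT nu &
    forall g : T -> \bar R, (forall z, D z -> h z = 0 -> g z = 0%E) ->
      (\int[nu]_(z in D) g z = \int[mu]_(z in D) g z)%E.
Proof.
pose nu : {measure set T -> \bar R} := mrestr mu mA.
exists nu => [|g g0].
  (* Index 0 is the complement of [A], which is null for the restricted measure; the other sets have
     finite measure by [S_fin]. *)
  exists (fun k => if k is k'.+1 then S k' `&` A else ~` A) => [|[|k]].
  - apply/seteqP; split => // z _; have [Az|Az] := pselect (A z); last by exists 0%N.
    have [Dz hz] := Az; exists (Num.truncn `|h z|^-1).+1 => //; split => //; split => //=.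
    rewrite -[leRHS]invrK lef_pV2 ?posrE ?ltr0n ?invr_gt0 ?normr_gt0//.
    exact/ltW/truncnS_gt.
  - split; first exact: measurableC.
    by rewrite /nu/= /mrestr setICl measure0 ltry.
  - split; first exact: measurableI.
    apply: le_lt_trans (S_fin k); rewrite /nu/= /mrestr.
    by apply: le_measure; rewrite ?inE//; [do 2 apply: measurableI => //|move=> z [[]]].
have gA : g \_ D = g \_ A.
  apply/funext => z; rewrite !patchE; case: ifPn => [|zD].
    rewrite inE => zD; case: ifPn => // zA; apply: g0 => //.
    apply: contra_notP (negP zA) => hz; rewrite inE; split => //=; exact/eqP.
  by rewrite ifF//; apply: contraNF zD; rewrite !inE => -[].
rewrite integral_mkcond gA -integral_mkcond [RHS]integral_mkcond gA -integral_mkcond.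
apply: eq_measure_integral => B mB BA.
by rewrite /nu/= /mrestr (setIidl BA).
Qed.

End integrable_support.

Lemma bounded_integrable d (T : measurableType d) (R : realType)
    (mu : {measure set T -> \bar R}) (A : set T) (f : T -> R) (M : R) :
  measurable A -> (mu A < +oo)%E -> measurable_fun A f ->
  (forall x, A x -> `|f x| <= M) -> mu.-integrable A (EFin \o f).
Proof.
move=> mA Afin mf fM; apply: measurable_bounded_integrable => //.
exists M; split; first exact: num_real.
by move=> N /ltW MN x /fM /le_trans; apply.
Qed.

Lemma ae_eq_Rintegral d (T : measurableType d) (R : realType)
    (mu : {measure set T -> \bar R}) (A : set T) (f g : T -> R) :
  measurable A -> measurable_fun A f -> measurable_fun A g ->
  {ae mu, forall y, A y -> f y = g y} ->
  \int[mu]_(y in A) f y = \int[mu]_(y in A) g y.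
Proof.
move=> mA mf mg fg; congr fine; apply: ae_eq_integral => //.
- exact/measurable_EFinP.
- exact/measurable_EFinP.
- by apply: filterS fg => y h Ay; rewrite h.
Qed.

Lemma dominated_Rintegral_cvg d (T : measurableType d) (R : realType)
    (mu : {measure set T -> \bar R}) (A : set T) (f_ : nat -> T -> R)
    (f g : T -> R) :
  measurable A -> (forall k, measurable_fun A (f_ k)) -> measurable_fun A f ->
  {ae mu, forall x, A x -> f_ ^~ x @ \oo --> f x} ->
  mu.-integrable A (EFin \o g) -> (forall k x, A x -> `|f_ k x| <= g x) ->
  \int[mu]_(x in A) f_ k x @[k --> \oo] --> \int[mu]_(x in A) f x.
Proof.
move=> mA mf_ mf cvf ig dom.
have mf_' k : measurable_fun A (EFin \o f_ k) by exact/measurable_EFinP.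
have mf' : measurable_fun A (EFin \o f) by exact/measurable_EFinP.
have cvf' : {ae mu, forall x, A x -> (EFin \o f_ k) x @[k --> \oo] --> (EFin \o f) x}.
  apply: filterS cvf => x h Ax; apply: cvg_EFin; first exact: nearW.
  exact: h.
have dom' : {ae mu, forall x k, A x -> (`|(EFin \o f_ k) x| <= (EFin \o g) x)%E}.
  by apply: aeW => x k Ax; rewrite lee_fin; exact: dom.
have [il _ cvl] := dominated_convergence mA mf_' mf' cvf' ig dom'.
by apply: fine_cvg; rewrite fineK//; exact: integrable_fin_num il.
Qed.

Section kernel_duality.
Context d1 d2 (T1 : measurableType d1) (T2 : measurableType d2) (R : realType).
Variables (mu : {measure set T1 -> \bar R}) (la : {measure set T2 -> \bar R}).
Hypothesis sla : sigma_finite setT la.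
Variables (D1 : set T1) (D2 : set T2) (k : T1 -> T2 -> R).
Hypotheses (mD1 : measurable D1) (mD2 : measurable D2).
Hypothesis la_fin : (la D2 < +oo)%E.
Hypothesis mk : measurable_fun (D1 `*` D2) (fun p => k p.1 p.2).
Variable W : T2 -> R.
Hypothesis kW : forall z y, 0 <= k z y <= W y.
Variable h : T1 -> R.
Hypothesis ih : mu.-integrable D1 (EFin \o h).

Let mh : measurable_fun D1 h.
Proof. by apply/measurable_EFinP; exact: measurable_int ih. Qed.

Let mah : measurable_fun D1 (fun z => `|(h z)%:E|%E).
Proof. by apply: measurableT_comp => //; exact/measurable_EFinP. Qed.

Let W0 (y : T2) : 0 <= W y.
Proof. by have /andP[] := kW point y; exact: le_trans. Qed.

(** Applied twice: with the truncated boundary kernel it is the solution, with the mollifiers it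
    gives the approximating densities. *)
Definition kernel_integral (y : T2) : R := \int[mu]_(z in D1) (k z y * h z).

Lemma kernel_integrand_integrable y : D2 y ->
  mu.-integrable D1 (fun z => (k z y * h z)%:E).
Proof.
move=> Dy; apply: (le_integrable mD1 (g := fun z => ((W y)%:E * (h z)%:E)%E)).
- apply/measurable_EFinP; apply: measurable_funM => //.
  exact: (measurable_fun_slice2 mD1 mD2 mk).
- move=> z Dz; rewrite lee_fin !normrM ler_wpM2r//.
  by have /andP[t0 t1] := kW z y; rewrite !ger0_norm// (le_trans t0).
- exact: integrableZl.
Qed.

Lemma kernel_integralE y : D2 y ->
  (kernel_integral y)%:E = (\int[mu]_(z in D1) (k z y * h z)%:E)%E.
Proof.
by move=> Dy; rewrite fineK//; apply: integrable_fin_num => //; exact: kernel_integrand_integrable.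
Qed.

Lemma kernel_integral_bound y : D2 y -> (`|(kernel_integral y)%:E| <=
  (W y)%:E * \int[mu]_(z in D1) `|(h z)%:E|)%E.
Proof.
move=> Dy; rewrite kernel_integralE//; have ip := kernel_integrand_integrable Dy.
apply: le_trans (le_abse_integral _ mD1 (measurable_int _ ip)) _.
rewrite -ge0_integralZl ?lee_fin//.
apply: ge0_le_integral => //.
- by apply: measurableT_comp => //; exact: measurable_int ip.
- exact: measurable_funeM.
- move=> z Dz; rewrite -EFinM lee_fin normrM ler_wpM2r//.
  by have /andP[t0 t1] := kW z y; rewrite ger0_norm.
Qed.

(** Fubini's theorem for [k z y * h z * psi y], which is dominated by [M * |h z|] over a set [D2] of
    finite measure. It is run with the sigma-finite [nu]; all integrands vanish with [h], so [nu]
    and [mu] give the same integrals. The bound [M] is asked of the product [k * psi] because [W]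
    may blow up where [psi] vanishes. *)
Lemma kernel_duality (psi : T2 -> R) (M : R) : measurable_fun D2 psi ->
  (forall z y, D1 z -> D2 y -> `|k z y * psi y| <= M) ->
  la.-integrable D2 (fun y => (kernel_integral y * psi y)%:E) /\
  (\int[la]_(y in D2) (kernel_integral y * psi y)%:E =
   \int[mu]_(z in D1) (h z * \int[la]_(y in D2) (k z y * psi y))%:E)%E.
Proof.
move=> mpsi kM.
have [nu snu nuE] := integrable_sigma_finite_support mD1 ih.
pose F z y : R := k z y * h z * psi y.
have mF : measurable_fun (D1 `*` D2) (fun p => F p.1 p.2).
  apply: measurable_funM; first (apply: measurable_funM).
  - exact: mk.
  - by apply: (measurable_comp mD1 _ mh) => [_ [p [? ?] <-]//|]; exact: measurable_funTS.
  - by apply: (measurable_comp mD2 _ mpsi) => [_ [p [? ?] <-]//|]; exact: measurable_funTS.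
have FM z y : D1 z -> D2 y -> `|F z y| <= M * `|h z|.
  by move=> Dz Dy; rewrite /F mulrAC normrM ler_wpM2r// kM.
have mFz := rectangle_tonelli_measurable mD1 mD2 mF sla.
have la0 : 0 <= fine (la D2) by rewrite fine_ge0.
pose c : R := `|M| * fine (la D2).
have Ffin : (\int[nu]_(z in D1) \int[la]_(y in D2) `|(F z y)%:E| < +oo)%E.
  apply: (@le_lt_trans _ _ (\int[nu]_(z in D1) (c%:E * `|(h z)%:E|))%E).
    apply: ge0_le_integral => //.
    - by move=> z Dz; exact: integral_ge0.
    - exact: measurable_funeM.
    - move=> z Dz; apply: (@le_trans _ _ (\int[la]_(y in D2) (`|M| * `|h z|)%:E)%E).
        apply: ge0_le_integral => //.
        + apply: measurableT_comp => //; apply/measurable_EFinP.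
          exact: (measurable_fun_slice1 mD1 mD2 mF Dz).
        + move=> y Dy; rewrite lee_fin (le_trans (FM _ _ Dz Dy))//.
          by rewrite ler_wpM2r// ler_norm.
      rewrite integral_cst// EFinM [leRHS](_ : _ =
        (`|M|%:E * la D2 * `|h z|%:E)%E); first by rewrite muleAC.
      by rewrite /c EFinM fineK ?ge0_fin_numE.
  rewrite nuE => [|z _ ->]; last by rewrite abse0 mule0.
  rewrite ge0_integralZl// ?lee_fin ?mulr_ge0//.
  by apply: lte_mul_pinfty => //; [rewrite lee_fin mulr_ge0|have /integrableP[] := ih].
have innerE y : D2 y ->
    (\int[nu]_(z in D1) (F z y)%:E = (kernel_integral y * psi y)%:E)%E.
  move=> Dy; rewrite nuE => [|z _ hz]; last by rewrite /F hz mulr0 mul0r.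
  rewrite EFinM kernel_integralE// -integralZr//; exact: kernel_integrand_integrable.
have outerE z : D1 z -> (\int[la]_(y in D2) (F z y)%:E =
    (h z * \int[la]_(y in D2) (k z y * psi y))%:E)%E.
  move=> Dz; have iz : la.-integrable D2 (fun y => (k z y * psi y)%:E).
    apply: (bounded_integrable (M := M)) => // [|y Dy]; last exact: kM.
    by apply: measurable_funM => //; exact: (measurable_fun_slice1 mD1 mD2 mk).
  rewrite EFinM /Rintegral fineK ?integrable_fin_num// -integralZl//.
  by apply: eq_integral => y _; rewrite /F -EFinM mulrAC mulrC.
split.
  apply: eq_integrable (rectangle_integrable2 mD1 mD2 mF snu sla Ffin) => //.
  by move=> y; rewrite inE => Dy; exact: innerE.
rewrite -nuE => [|z _ ->]; last by rewrite mul0r.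
transitivity (\int[la]_(y in D2) \int[nu]_(z in D1) (F z y)%:E)%E.
  by apply: eq_integral => y; rewrite inE => Dy; rewrite innerE.
rewrite -(rectangle_fubini mD1 mD2 mF snu sla Ffin).
by apply: eq_integral => z; rewrite inE => Dz; rewrite outerE.
Qed.

(** The null set of [y] on which the kernels differ varies with [z]. All these sets are sections of
    one measurable set [E], so for almost every [y] the kernels agree at [nu]-almost every [z],
    which is enough for the integrals against [h]. *)
Lemma kernel_integral_ae (k' : T1 -> T2 -> R) :
  measurable_fun (D1 `*` D2) (fun p => k' p.1 p.2) ->
  (forall z, D1 z -> {ae la, forall y, D2 y -> k z y = k' z y}) ->
  {ae la, forall y, D2 y ->
    (kernel_integral y)%:E = (\int[mu]_(z in D1) (k' z y * h z)%:E)%E}.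
Proof.
move=> mk' kk'; have [nu snu nuE] := integrable_sigma_finite_support mD1 ih.
have mD12 : measurable (D1 `*` D2) by exact: measurableX.
pose E := [set p : T1 * T2 | (D1 `*` D2) p /\ k p.1 p.2 != k' p.1 p.2].
have mE : measurable E.
  rewrite (_ : E = (D1 `*` D2) `&`
      (fun p => k p.1 p.2 - k' p.1 p.2) @^-1` (~` [set 0])).
    by apply: measurable_funB => //; exact: measurableC.
  apply/seteqP; split => p [Dp] /= ne; split => //.
    by move=> /eqP; rewrite subr_eq0 => /eqP e; move: ne; rewrite e eqxx.
  by apply/eqP => e; apply: ne; rewrite e subrr.
have E0 z : la (xsection E z) = 0%E.
  have [Dz|Dz] := pselect (D1 z); last first.
    rewrite (_ : xsection E z = set0) ?measure0// -subset0 => y.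
    by rewrite /xsection /= inE => -[[]].
  have [N [mN N0 sub]] := kk' z Dz.
  apply: (subset_measure0 _ mN _ N0); first exact: measurable_xsection.
  move=> y; rewrite /xsection /= inE => -[[_ /= Dy] /eqP ne]; apply: sub.
  by move=> /(_ Dy).
apply: filterS (ae_ysection_null snu sla mE E0) => y Ey Dy.
rewrite kernel_integralE//.
rewrite -nuE => [|z _ ->]; last by rewrite mulr0.
rewrite -nuE => [|z _ ->]; last by rewrite mulr0.
have mky (l : T1 -> T2 -> R) : measurable_fun (D1 `*` D2) (fun p => l p.1 p.2) ->
    measurable_fun D1 (fun z => (l z y * h z)%:E).
  move=> ml; apply/measurable_EFinP; apply: measurable_funM => //.
  exact: (measurable_fun_slice2 mD1 mD2 ml).
apply: ae_eq_integral; [by []|exact: mky|exact: mky|].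
exists (ysection E y); split => //; first exact: measurable_ysection.
move=> z /= /not_implyP[Dz ne]; rewrite /ysection /= inE; split => //=.
by apply/eqP => e; apply: ne; rewrite e.
Qed.

End kernel_duality.

(* Two functions agree as soon as their difference is orthogonal to its own
   truncation. *)
Lemma ae_eq_of_clipped_test d (T : measurableType d) (R : realType)
    (mu : {measure set T -> \bar R}) (K : set T) (u v : T -> R) :
  measurable K -> mu.-integrable K (EFin \o u) -> mu.-integrable K (EFin \o v) ->
  (forall phi : T -> R, measurable_fun K phi -> (forall x, `|phi x| <= 1) ->
     (\int[mu]_(x in K) (v x * phi x)%:E = \int[mu]_(x in K) (u x * phi x)%:E)%E) ->
  {ae mu, forall x, K x -> v x = u x}.
Proof.
move=> mK iu iv test.
have mu' : measurable_fun K u by apply/measurable_EFinP; exact: measurable_int iu.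
have mv : measurable_fun K v by apply/measurable_EFinP; exact: measurable_int iv.
pose phi x : R := Num.max (-1) (Num.min 1 (v x - u x)).
have phi1 x : `|phi x| <= 1.
  rewrite ler_norml /phi le_max lexx/= ge_max ge_min lexx/= andbT; lra.
have mphi : measurable_fun K phi.
  apply: measurable_maxr => //; apply: measurable_minr => //.
  exact: measurable_funB.
have iphi (w : T -> R) : mu.-integrable K (EFin \o w) ->
    mu.-integrable K (EFin \o (fun x => w x * phi x)).
  move=> iw; apply: (le_integrable mK _ _ iw).
    apply/measurable_EFinP; apply: measurable_funM => //.
    by apply/measurable_EFinP; exact: measurable_int iw.
  by move=> x _; rewrite lee_fin normrM ler_piMr.
(* A number times its truncation to [[-1, 1]] is nonnegative, and vanishes only when the number
   does. *)
have w0 x : 0 <= (v x - u x) * phi x.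
  rewrite /phi; case: (leP 0 (v x - u x)) => w0.
    by rewrite mulr_ge0// le_max le_min ler01 w0 orbT.
  rewrite mulr_le0 ?(ltW w0)// ge_max ge_min (ltW w0) orbT andbT; lra.
have : (\int[mu]_(x in K) `|((v x - u x) * phi x)%:E| = 0)%E.
  transitivity (\int[mu]_(x in K) ((v x * phi x)%:E - (u x * phi x)%:E))%E.
    by apply: eq_integral => x _; rewrite gee0_abs ?lee_fin// -EFinB mulrBl.
  rewrite integralB_EFin//; [|exact: iphi..].
  rewrite test// subee//; apply: integrable_fin_num => //; exact: (iphi u).
have mw : measurable_fun K (fun x => ((v x - u x) * phi x)%:E).
  apply/measurable_EFinP; apply: measurable_funM => //; exact: measurable_funB.
move=> /(ae_eq_integral_abs mu mK mw); apply: filterS => x /[apply] /= -[] /eqP.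
rewrite mulf_eq0 subr_eq0 => /orP[/eqP//|/eqP p0].
apply/eqP; rewrite -subr_eq0; move: p0; rewrite /phi.
case: ltgtP => // w p0.
  have : Num.max (-1) (Num.min 1 (v x - u x)) < 0.
    by rewrite gt_max gt_min w orbT andbT ltrN10.
  by rewrite p0 ltxx.
have : 0 < Num.max (-1) (Num.min 1 (v x - u x)).
  by rewrite lt_max lt_min ltr01 w orbT.
by rewrite p0 ltxx.
Qed.

Lemma average_close d (T : measurableType d) (R : realType)
    (mu : {measure set T -> \bar R}) (A : set T) (w : T -> R) (l eps : R) :
  measurable A -> (0 < mu A)%E -> (mu A < +oo)%E -> measurable_fun A w ->
  (forall x, A x -> `|w x - l| <= eps) ->
  `|(fine (mu A))^-1 * \int[mu]_(x in A) w x - l| <= eps.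
Proof.
move=> mA A0 Aoo mw wl; pose m := fine (mu A).
have m0 : 0 < m by rewrite fine_gt0// A0.
have icst (c : R) : mu.-integrable A (EFin \o cst c).
  by apply: (bounded_integrable (M := `|c|)).
have iwl : mu.-integrable A (EFin \o (fun x => w x - l)).
  by apply: (bounded_integrable (M := eps)) => //; exact: measurable_funB.
have -> : m^-1 * \int[mu]_(x in A) w x - l = m^-1 * \int[mu]_(x in A) (w x - l).
  have iw : mu.-integrable A (EFin \o w).
    apply: (bounded_integrable (M := eps + `|l|)) => // x Ax.
    by rewrite -[w x](subrK l) (le_trans (ler_normD _ _))// lerD2r wl.
  rewrite (RintegralB mA iw (icst l)) Rintegral_cst// mulrBr.
  by rewrite -/m mulrCA mulVf ?gt_eqF// mulr1.
rewrite normrM ger0_norm ?invr_ge0 ?(ltW m0)// mulrC ler_pdivrMr//.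
apply: le_trans (le_normr_Rintegral mA iwl) _.
rewrite -[leRHS](Rintegral_cst _ mA); apply: le_Rintegral => //; last exact: icst.
by rewrite (_ : EFin \o _ = (fun x => `|(w x - l)%:E|%E))//; exact: integrable_abse.
Qed.

Section symmetric_operator.
Context d (T : measurableType d) (R : realType) (la : {measure set T -> \bar R}).
Hypothesis sla : sigma_finite setT la.
Variables (D : set T) (G : T -> T -> R) (M : R).
Hypotheses (mD : measurable D) (la_fin : (la D < +oo)%E).
Hypothesis mG : measurable_fun (D `*` D) (fun p => G p.1 p.2).
Hypothesis symG : forall x y, D x -> D y -> G x y = G y x.
Hypothesis massG : forall x, D x -> (\int[la]_(y in D) `|(G x y)%:E| <= M%:E)%E.

Definition kernel_operator (f : T -> R) (x : T) : R :=
  \int[la]_(y in D) (G x y * f y).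

Section bounded_argument.
Variables (f : T -> R) (B : R).
Hypotheses (mf : measurable_fun D f) (fB : forall x, D x -> `|f x| <= B).

Lemma kernel_operator_integrable x : D x ->
  la.-integrable D (fun y => (G x y * f y)%:E).
Proof.
move=> Dx; have mGx := measurable_fun_slice1 mD mD mG Dx.
apply: (le_integrable mD (g := fun y => (B%:E * (G x y)%:E)%E)).
- by apply/measurable_EFinP; exact: measurable_funM.
- move=> y Dy; rewrite lee_fin !normrM mulrC ler_wpM2r//.
  by apply: le_trans (fB Dy) _; exact: ler_norm.
- apply: integrableZl => //; apply/integrableP; split.
    exact/measurable_EFinP.
  by apply: le_lt_trans (massG Dx) (ltry _).
Qed.

Lemma kernel_operator_mass x : D x -> 0 <= B ->
  (\int[la]_(y in D) `|(G x y * f y)%:E| <= (B * M)%:E)%E.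
Proof.
move=> Dx B0; have mGx := measurable_fun_slice1 mD mD mG Dx.
apply: (@le_trans _ _ (\int[la]_(y in D) (B%:E * `|(G x y)%:E|))%E).
  apply: ge0_le_integral => //.
  - apply: measurableT_comp => //; apply/measurable_EFinP; exact: measurable_funM.
  - apply: measurable_funeM; apply: measurableT_comp => //; exact/measurable_EFinP.
  - by move=> y Dy; rewrite -EFinM lee_fin normrM mulrC ler_wpM2r// fB.
rewrite ge0_integralZl ?lee_fin//; last first.
  by apply: measurableT_comp => //; exact/measurable_EFinP.
by rewrite EFinM lee_wpmul2l ?lee_fin// massG.
Qed.

Lemma kernel_operator_bound x : D x -> 0 <= B -> `|kernel_operator f x| <= B * M.
Proof.
move=> Dx B0; rewrite -lee_fin; have ig := kernel_operator_integrable Dx.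
rewrite (EFin_normr_Rintegral mD ig).
apply: le_trans (le_abse_integral _ mD (measurable_int _ ig)) _.
exact: kernel_operator_mass.
Qed.

Let measurable_integrand :
  measurable_fun (D `*` D) (fun p : T * T => G p.1 p.2 * f p.2).
Proof.
apply: measurable_funM => //.
by apply: (measurable_comp mD _ mf) => [_ [p [? ?] <-]//|]; exact: measurable_funTS.
Qed.

Lemma measurable_kernel_operator : 0 <= B -> measurable_fun D (kernel_operator f).
Proof.
move=> B0; apply/measurable_EFinP.
have Ffin : (\int[la]_(x in D) \int[la]_(y in D) `|(G x y * f y)%:E| < +oo)%E.
  apply: (@le_lt_trans _ _ (\int[la]_(x in D) (B * M)%:E)%E).
    apply: ge0_le_integral => //.
    - by move=> x Dx; exact: integral_ge0.
    - exact: (rectangle_tonelli_measurable mD mD (F := fun x y => G x y * f y)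
        measurable_integrand sla).
    - by move=> x Dx; exact: kernel_operator_mass.
  rewrite integral_cst//; have [BM0|BM0] := leP 0 (B * M).
    by apply: lte_mul_pinfty => //; rewrite lee_fin.
  by apply: (@le_lt_trans _ _ 0%E) => //; rewrite mule_le0_ge0// lee_fin ltW.
have := rectangle_integrable1 mD mD (F := fun x y => G x y * f y)
  measurable_integrand sla sla Ffin.
move/measurable_int; apply: eq_measurable_fun => x; rewrite inE => Dx.
by rewrite /= /kernel_operator /Rintegral fineK// integrable_fin_num//; exact: kernel_operator_integrable.
Qed.

End bounded_argument.

(** Fubini's theorem and [symG]. The kernel may be singular, but each slice has absolute mass at
    most [M]; with [f] and [g] bounded and [D] of finite measure, the double integral converges
    absolutely. *)
Lemma kernel_operator_symmetric (f g : T -> R) (Bf Bg : R) : 0 <= Bf -> 0 <= Bg ->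
  measurable_fun D f -> measurable_fun D g ->
  (forall x, D x -> `|f x| <= Bf) -> (forall x, D x -> `|g x| <= Bg) ->
  \int[la]_(x in D) (kernel_operator f x * g x) =
  \int[la]_(x in D) (f x * kernel_operator g x).
Proof.
move=> Bf0 Bg0 mf mg fB gB.
pose F x y := G x y * f y * g x.
have mF : measurable_fun (D `*` D) (fun p => F p.1 p.2).
  apply: measurable_funM; first (apply: measurable_funM => //).
  - by apply: (measurable_comp mD _ mf) => [_ [p [? ?] <-]//|]; exact: measurable_funTS.
  - by apply: (measurable_comp mD _ mg) => [_ [p [? ?] <-]//|]; exact: measurable_funTS.
have innerE x : D x ->
    (\int[la]_(y in D) (F x y)%:E = (kernel_operator f x * g x)%:E)%E.
  move=> Dx; have ix := kernel_operator_integrable mf fB Dx.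
  by rewrite EFinM /kernel_operator /Rintegral fineK ?integrable_fin_num// -integralZr.
have outerE y : D y ->
    (\int[la]_(x in D) (F x y)%:E = (f y * kernel_operator g y)%:E)%E.
  move=> Dy; have iy := kernel_operator_integrable mg gB Dy.
  rewrite EFinM /kernel_operator /Rintegral fineK ?integrable_fin_num// -integralZl//.
  apply: eq_integral => x; rewrite inE => Dx.
  by rewrite -EFinM /F (symG Dx Dy) mulrAC mulrC.
have Ffin : (\int[la]_(x in D) \int[la]_(y in D) `|(F x y)%:E| < +oo)%E.
  apply: (@le_lt_trans _ _ (\int[la]_(x in D) (`|Bf * M| * Bg)%:E)%E); last first.
    by rewrite integral_cst//; apply: lte_mul_pinfty => //; rewrite lee_fin mulr_ge0.
  apply: ge0_le_integral => //.
  - by move=> x Dx; exact: integral_ge0.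
  - exact: (rectangle_tonelli_measurable mD mD mF sla).
  - move=> x Dx; have ix := kernel_operator_integrable mf fB Dx.
    under eq_integral do rewrite /F EFinM abseM.
    rewrite ge0_integralZr//; last first.
      by apply: measurableT_comp => //; exact: measurable_int ix.
    rewrite EFinM; apply: lee_pmul => //.
    + exact: integral_ge0.
    + apply: le_trans (kernel_operator_mass mf fB Dx Bf0) _.
      by rewrite lee_fin ler_norm.
    + by rewrite lee_fin gB.
congr fine.
transitivity (\int[la]_(x in D) \int[la]_(y in D) (F x y)%:E)%E.
  by apply: eq_integral => x; rewrite inE => Dx; rewrite innerE.
rewrite (rectangle_fubini mD mD mF sla sla Ffin).
by apply: eq_integral => y; rewrite inE => Dy; rewrite outerE.
Qed.

End symmetric_operator.

(** The slices may fail to be integrable. Tonelli's theorem handles the positive and negative parts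
    separately, and their difference is measurable in the extended reals, infinite values
    included. *)
Lemma measurable_Rintegral_slice d1 d2 (T1 : measurableType d1)
    (T2 : measurableType d2) (R : realType) (la : {measure set T2 -> \bar R})
    (D1 : set T1) (D2 : set T2) (F : T1 -> T2 -> R) :
  sigma_finite setT la -> measurable D1 -> measurable D2 ->
  measurable_fun (D1 `*` D2) (fun p => F p.1 p.2) ->
  measurable_fun D1 (fun x => \int[la]_(y in D2) F x y).
Proof.
move=> sla mD1 mD2 mF.
pose Fp x y := Num.max (F x y) 0; pose Fm x y := Num.max (- F x y) 0.
have mFp : measurable_fun (D1 `*` D2) (fun p => Fp p.1 p.2).
  exact: measurable_maxr.
have mFm : measurable_fun (D1 `*` D2) (fun p => Fm p.1 p.2).
  by apply: measurable_maxr => //; exact: measurableT_comp.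
have mp := rectangle_tonelli_measurable mD1 mD2 mFp sla.
have mm := rectangle_tonelli_measurable mD1 mD2 mFm sla.
rewrite (_ : (fun x => _) = fine \o ((fun x => \int[la]_(y in D2) `|(Fp x y)%:E|) \-
    (fun x => \int[la]_(y in D2) `|(Fm x y)%:E|))%E).
  by apply: measurableT_comp => //; exact: emeasurable_funB.
apply/funext => x /=; rewrite /Rintegral integralE; congr (fine (_ - _))%E.
- apply: eq_integral => y _.
  by rewrite funeposE -EFin_max ger0_norm// /Fp le_max lexx orbT.
- apply: eq_integral => y _.
  by rewrite funenegE -EFinN -EFin_max ger0_norm// /Fm le_max lexx orbT.
Qed.

(** * Riesz potentials *)

(* [r^(-a)] is compared with the series of dyadic indicators
   [(2^(-k-1))^(-a) 1_(r <= 2^(-k))]. *)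
Lemma dyadic_powR_le (R : realType) (a r : R) : 0 <= a -> 0 <= r ->
  ((r `^ (- a))%:E <= 1 + \sum_(k <oo)
     (((2^-1 ^+ k.+1) `^ (- a)) * (r <= 2^-1 ^+ k)%R%:R)%:E)%E.
Proof.
move=> a0 r0.
have c0 k : (0 <= (((2^-1 ^+ k.+1) `^ (- a)) * (r <= 2^-1 ^+ k)%R%:R : R)%:E)%E.
  by rewrite lee_fin mulr_ge0// powR_ge0.
have S0 : (0 <= \sum_(k <oo) (((2^-1 ^+ k.+1) `^ (- a)) *
    (r <= 2^-1 ^+ k)%R%:R : R)%:E)%E by exact: nneseries_ge0.
have le1 : r `^ (- a) <= 1 -> ((r `^ (- a))%:E <= 1 + \sum_(k <oo)
     (((2^-1 ^+ k.+1) `^ (- a)) * (r <= 2^-1 ^+ k)%R%:R)%:E)%E.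
  by move=> h; rewrite -[leLHS]adde0; apply: leeD.
(* At [r = 0] the real power is 0 by convention when [a] is nonzero, and 1 when [a] is 0. *)
have [r_0|rn0] := eqVneq r 0.
  have [a_0|an0] := eqVneq a 0; first by apply: le1; rewrite a_0 oppr0 powRr0.
  by apply: le1; rewrite r_0 powR0 ?oppr_eq0.
have rp : 0 < r by rewrite lt_neqAle eq_sym rn0.
have [r1|r1] := leP 1 r.
  apply: le1; rewrite powRN invf_le1 ?powR_gt0//.
  by rewrite -(powRr0 r) ler_powR.
have ex : exists m, (2^-1 : R) ^+ m < r.
  exists (Num.truncn r^-1).+1; rewrite exprVn invf_plt ?posrE ?exprn_gt0//.
  apply: (lt_le_trans (truncnS_gt _)).
  by rewrite -natrX ler_nat ltnW// ltn_expl.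
(* Minimality of the exponent [k.+1] places [r] in the dyadic interval from [2^-1 ^+ k.+1] to
   [2^-1 ^+ k], so the single term of index [k] suffices. *)
have := ex_minnP ex => -[[|k] hk kmin].
  by move: hk; rewrite expr0 ltNge (ltW r1).
have hk' : r <= 2^-1 ^+ k.
  by rewrite leNgt; apply/negP => /kmin; rewrite ltnn.
rewrite -[leLHS]add0e; apply: leeD => //.
rewrite (@nneseriesD1 _ _ k xpredT)//; rewrite -[leLHS]adde0; apply: leeD; last exact: nneseries_ge0.
rewrite hk' mulr1 lee_fin !powRN lef_pV2 ?posrE ?powR_gt0 ?exprn_gt0//.
by apply: ge0_ler_powR; rewrite ?nnegrE ?exprn_ge0// ltW.
Qed.

Lemma dyadic_integral_le d (T : measurableType d) (R : realType)
    (mu : {measure set T -> \bar R}) (A : set T) (r : T -> R) (a : R)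
    (V : nat -> R) :
  0 <= a -> measurable A -> measurable_fun A r -> (forall y, 0 <= r y) ->
  (forall k, (mu (A `&` [set y | (r y <= 2^-1 ^+ k)%R]) <= (V k)%:E)%E) ->
  (\int[mu]_(y in A) (r y `^ (- a))%:E <=
     mu A + \sum_(k <oo) ((2^-1 ^+ k.+1) `^ (- a) * V k)%:E)%E.
Proof.
move=> a0 mA mr r0 muV; pose c k : R := (2^-1 ^+ k.+1) `^ (- a).
have c0 k : 0 <= c k by exact: powR_ge0.
pose B k := A `&` [set y | r y <= 2^-1 ^+ k].
have mB k : measurable (B k).
  rewrite (_ : B k = A `&` r @^-1` `]-oo, 2^-1 ^+ k]%classic); first exact: mr.
  by apply/seteqP; split => y [Ay /=]; rewrite in_itv/=.
pose f k (y : T) : \bar R := ((c k)%:E * (\1_(B k) y)%:E)%E.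
have m1 k : measurable_fun A (fun y => (\1_(B k) y : R)%:E).
  by apply/measurable_EFinP; apply: measurable_funTS; exact/measurable_indicP.
have mf k : measurable_fun A (f k) by exact: measurable_funeM.
have f0 k y : (0 <= f k y)%E by rewrite mule_ge0// lee_fin.
have msum : measurable_fun A (fun y => \sum_(k <oo) f k y)%E.
  by apply: (@ge0_emeasurable_sum _ _ _ A f xpredT) => [k y _ _|k _].
apply: (@le_trans _ _ (\int[mu]_(y in A) (1 + \sum_(k <oo) f k y))%E).
  apply: ge0_le_integral => //.
  - by move=> y _; rewrite lee_fin powR_ge0.
  - apply/measurable_EFinP.
    exact: (measurableT_comp (measurable_powR _)).
  - exact: emeasurable_funD.
  - move=> y Ay; apply: le_trans (dyadic_powR_le a0 (r0 y)) _.
    apply: leeD => //; rewrite le_eqVlt; apply/orP; left; apply/eqP.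
    apply: eq_eseriesr => k _; rewrite /f -EFinM indicE; congr (_ * _%:R)%:E.
    congr nat_of_bool; apply/idP/idP; rewrite inE; first by split.
    by case.
rewrite ge0_integralD//; last by move=> y _; exact: nneseries_ge0.
rewrite integral_cst// mul1e integral_nneseries//.
apply: leeD => //; apply: lee_nneseries => [k _ _|k _].
  exact: integral_ge0.
rewrite ge0_integralZl ?lee_fin// integral_indic// EFinM.
apply: lee_wpmul2l; first by rewrite lee_fin.
by rewrite (setIidl (_ : B k `<=` A)); [exact: muV|move=> y []].
Qed.

Section lebesgue_facts.
Context (R : realType) (n : nat).
Implicit Types (x y : 'rV[R]_n) (A : set 'rV[R]_n).

Lemma rbox_diag x : rbox x x = [set x].
Proof.
apply/seteqP; split => [y h|_ -> i]; last by rewrite lexx.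
by apply/rowP => i; have := h i => /le_anti.
Qed.

Lemma leb_point x : (0 < n)%N -> leb R n [set x] = 0%E.
Proof.
move=> n0; apply/eqP; rewrite eq_le measure_ge0 andbT -rbox_diag.
apply: le_trans (leb_rbox_le _) _ => //.
by rewrite (bigD1 (Ordinal n0))//= subrr mul0r.
Qed.

Lemma continuous_measurable_leb (f : 'rV[R]_n -> R) : continuous f ->
  measurable_fun setT (f : leb_space R n -> R).
Proof.
move=> /continuousP cf; apply: (measurability _ (RGenOpens.measurableE R)).
move=> _ [_ [a [b ->] <-]]; rewrite setTI; apply: lebesgue_open_measurable.
exact/cf/interval_open.
Qed.

Lemma leb_norm_ball x t : 0 <= t ->
  (leb R n [set y | (`|x - y| <= t)%R] <= ((2 * t) ^+ n)%:E)%E.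
Proof.
move=> t0; pose a := x - const_mx t; pose b := x + const_mx t.
have -> : ((2 * t) ^+ n)%:E = (\prod_(i < n) (b 0 i - a 0 i))%:E.
  rewrite -[X in _ ^+ X]card_ord -prodr_const; congr EFin.
  by apply: eq_bigr => i _; rewrite !mxE; ring.
apply: le_trans (leb_rbox_le _); last by move=> i; rewrite !mxE; lra.
apply: le_outer_measure => y /= xy i.
have := le_trans (coord_le_norm (x - y) i) xy.
by rewrite !mxE ler_norml; lra.
Qed.

Lemma continuous_dist x : continuous (fun y => `|x - y|).
Proof.
move=> y; apply: (@cvg_norm _ _ _ (nbhs y) (nbhs_filter y)).
by apply: cvgB; [exact: cvg_cst|exact: cvg_id].
Qed.

Lemma measurable_norm_ball x t :
  measurable ([set y | `|x - y| <= t] : set (leb_space R n)).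
Proof.
apply: lebesgue_closed_measurable.
have -> : [set y | `|x - y| <= t] = (fun y => `|x - y|) @^-1` [set r | r <= t] by [].
apply: closed_comp; last exact: closed_le.
by move=> y _; exact: continuous_dist.
Qed.

(** A geometric series: its ratio [q] is 2 to the power [a - n], which is below 1 because
    [a < n]. *)
Lemma dyadic_series_le (a : R) : a < n%:R ->
  exists2 M : R, 0 <= M & (\sum_(k <oo)
    ((2^-1 ^+ k.+1) `^ (- a) * (2 * 2^-1 ^+ k) ^+ n)%:E <= M%:E)%E.
Proof.
move=> an; pose q : R := 2^-1 `^ (n%:R - a).
have q0 : 0 <= q by exact: powR_ge0.
have q1 : q < 1.
  have := @gt0_ltr_powR R (n%:R - a) _ 2^-1 1; rewrite powR1; apply.
  - by rewrite subr_gt0.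
  - by rewrite nnegrE.
  - by rewrite nnegrE.
  - by rewrite invf_lt1// ltr1n.
pose c : R := 2^-1 `^ (- a) * 2 ^+ n.
have c0 : 0 <= c by rewrite mulr_ge0// powR_ge0.
have E k : (2^-1 ^+ k.+1) `^ (- a) * (2 * 2^-1 ^+ k) ^+ n = c * q ^+ k.
  rewrite exprS powRM// ?exprn_ge0// exprMn /c -!mulrA; congr (_ * _).
  rewrite mulrCA; congr (_ * _).
  rewrite -[X in _ * X]powR_mulrn ?exprn_ge0// -powRD; last first.
    by rewrite expf_neq0 ?implybT// invr_neq0.
  rewrite addrC -[2^-1 ^+ k]powR_mulrn; last by rewrite invr_ge0.
  by rewrite powRAC powR_mulrn// powR_ge0.
exists (c * (1 - q)^-1); first by rewrite mulr_ge0// invr_ge0 subr_ge0 ltW.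
apply: lime_le.
  by apply: is_cvg_nneseries => k _ _; rewrite lee_fin E mulr_ge0// exprn_ge0.
apply: nearW => m; rewrite sumEFin lee_fin.
under eq_bigr do rewrite E.
apply: geometric_le_lim => //; first by rewrite powR_gt0.
by rewrite ger0_norm.
Qed.

(** The cube of centre [x] and half-side [2^-1 ^+ k] has volume at most [(2 * 2^-1 ^+ k) ^+ n]
    wherever [x] lies, so the dyadic estimate is uniform in [x]. *)
Lemma riesz_potential_bound (a : R) (A : set (leb_space R n)) :
  0 <= a < n%:R -> measurable A -> bounded_set (A : set 'rV[R]_n) ->
  exists2 M : R, 0 <= M &
    forall x, (\int[leb R n]_(y in A) (`|x - y| `^ (- a))%:E <= M%:E)%E.
Proof.
move=> /andP[a0 an] mA bA; have [M M0 hM] := dyadic_series_le an.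
have Aoo := leb_bounded_ltoo mA bA.
exists (fine (leb R n A) + M); first by rewrite addr_ge0// fine_ge0.
move=> x.
have mr : measurable_fun A (fun y : leb_space R n => `|x - y|).
  apply: measurable_funTS; apply: continuous_measurable_leb.
  exact: continuous_dist.
rewrite EFinD fineK; last by rewrite ge0_fin_numE.
apply: le_trans (leeD2l _ hM).
apply: (dyadic_integral_le a0 mA mr (fun y => normr_ge0 (x - y))) => k.
apply: le_trans (@leb_norm_ball x (2^-1 ^+ k) _); last by rewrite exprn_ge0.
by apply: le_outer_measure => y [].
Qed.

End lebesgue_facts.

(** * Green kernels *)

Section green_kernel_bounds.
Context (R : realType) (n : nat) (Omega : set 'rV[R]_n).
Hypotheses (n0 : (0 < n)%N) (Oopen : open Omega) (Obdd : bounded_set Omega).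
Hypothesis D0 : boundary Omega !=set0.
Context (s gamma : R) (G : 'rV[R]_n -> 'rV[R]_n -> R).
Hypothesis hG : green_kernel Omega s gamma G.
Local Notation delta := (delta Omega).

Let mO : measurable (Omega : set (leb_space R n)).
Proof. exact: lebesgue_open_measurable. Qed.

Lemma green_slice_measurable x : Omega x ->
  measurable_fun (Omega : set (leb_space R n)) (G x).
Proof.
have [_ _ mG _ _] := hG => Ox.
exact: (@measurable_fun_slice1 _ _ (leb_space R n) (leb_space R n) R Omega Omega
  (fun x y => G x y)).
Qed.

Lemma green_upper : exists2 C : R, 0 < C & forall x y, Omega x -> Omega y ->
  x != y -> 0 <= G x y <= C * ((enorm (x - y) `^ (n%:R - 2 * s))^-1 *
     (Num.min (delta x * delta y / enorm (x - y) ^+ 2) 1) `^ gamma).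
Proof.
have [_ _ _ _ [C C0 h]] := hG; exists C => // x y Ox Oy xy.
have /andP[h1 ->] := h (x, y) (And3 Ox Oy xy); rewrite andbT.
apply: le_trans h1; rewrite mulr_ge0 ?invr_ge0 ?(ltW C0)//.
by rewrite mulr_ge0 ?invr_ge0 ?powR_ge0.
Qed.

(** The minimum in the kernel bound is at most 1, which leaves a Riesz kernel of exponent
    [n - 2 * s], below [n] as [s > 0]. The point [y = x], where [G] is arbitrary, is null because
    [n > 0]. *)
Lemma green_mass : exists2 M : R, 0 <= M &
  forall x, Omega x -> (\int[leb R n]_(y in Omega) `|(G x y)%:E| <= M%:E)%E.
Proof.
have [/andP[/andP[s0 s1] /andP[g0 g1]] sn _ _ _] := hG.
have [C C0 hC] := green_upper.
have [|M M0 hM] := @riesz_potential_bound R n (n%:R - 2 * s) Omega _ mO Obdd.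
  by rewrite subr_ge0 sn/= ltrBlDr ltrDl mulr_gt0.
exists (C * M); first by rewrite mulr_ge0// ltW.
move=> x Ox; have mp : measurable_fun (Omega : set (leb_space R n))
    (fun y => (`|x - y| `^ (- (n%:R - 2 * s)))%:E).
  apply/measurable_EFinP; apply: measurable_funTS.
  apply: (measurableT_comp (measurable_powR _)).
  by apply: continuous_measurable_leb; exact: continuous_dist.
apply: (@le_trans _ _ (\int[leb R n]_(y in Omega)
    (C%:E * (`|x - y| `^ (- (n%:R - 2 * s)))%:E))%E); last first.
  rewrite ge0_integralZl//; last by rewrite lee_fin ltW.
  by rewrite EFinM lee_wpmul2l ?lee_fin ?(ltW C0).
apply: (ae_ge0_le_integral mO).
- by move=> y _; exact: abse_ge0.
- apply: measurableT_comp; first exact: abse_measurable.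
  by apply/measurable_EFinP; exact: green_slice_measurable.
- by move=> y _; rewrite mule_ge0// lee_fin ?powR_ge0// ltW.
- exact: measurable_funeM.
exists [set x]; split.
- by rewrite -rbox_diag; exact: measurable_rbox.
- exact: leb_point.
move=> y /= /not_implyP[Oy]; apply: contra_notP => /eqP yx.
have xy : x != y by rewrite eq_sym.
have /andP[G0 G1] := hC x y Ox Oy xy.
have nxy : 0 < `|x - y| by rewrite normr_gt0 subr_eq0.
rewrite ger0_norm// -EFinM lee_fin; apply: le_trans G1 _.
rewrite ler_pM2l//; apply: (@le_trans _ _ ((enorm (x - y) `^ (n%:R - 2 * s))^-1 * 1)).
  rewrite ler_wpM2l ?invr_ge0 ?powR_ge0//.
  rewrite [leRHS](_ : 1 = 1 `^ gamma); last by rewrite powR1.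
  apply: ge0_ler_powR; rewrite ?nnegrE ?(ltW g0)//.
    by rewrite le_min ler01 andbT divr_ge0 ?sqr_ge0// mulr_ge0 ?delta_ge0.
  by rewrite ge_min lexx orbT.
rewrite mulr1 powRN lef_pV2 ?posrE ?powR_gt0//; last exact: lt_le_trans (norm_le_enorm _).
by apply: ge0_ler_powR; rewrite ?nnegrE ?subr_ge0 ?enorm_ge0// norm_le_enorm.
Qed.

Definition boundary_weight (y : 'rV[R]_n) : R := delta y `^ (2 * s - n%:R - gamma).

(** In the minimum the term [delta x * delta y / |x - y|^2] is kept. Its factor [delta x] to the
    power [gamma] cancels the denominator, and the remaining power of [|x - y|], of exponent
    [- (n - 2 s + 2 gamma)], is largest at [|x - y| = delta y / 2]. Hence the factor 2 to the power
    [a + 2 * gamma]. *)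
Lemma green_normalized_bound : exists2 C : R, 0 < C &
  forall x y, Omega x -> Omega y -> delta y / 2 <= enorm (x - y) ->
    0 <= G x y / delta x `^ gamma <= C * boundary_weight y.
Proof.
have [/andP[/andP[s0 s1] /andP[g0 g1]] sn _ _ _] := hG.
have [C C0 hC] := green_upper.
pose a := n%:R - 2 * s; have a0 : 0 <= a by rewrite subr_ge0.
exists (C * 2 `^ (a + 2 * gamma)); first by rewrite mulr_gt0// powR_gt0.
move=> x y Ox Oy xy.
have dx : 0 < delta x by exact: delta_gt0.
have dy : 0 < delta y by exact: delta_gt0.
have e0 : 0 < enorm (x - y) by apply: lt_le_trans xy; rewrite divr_gt0.
have nxy : x != y.
  apply: contraTneq e0 => ->; rewrite subrr -leNgt.
  by apply: le_trans (enorm_le_norm _) _; rewrite normr0 mulr0.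
have /andP[G0 G1] := hC x y Ox Oy nxy.
rewrite divr_ge0 ?powR_ge0//= ler_pdivrMr ?powR_gt0//.
apply: le_trans G1 _; rewrite -[leRHS]mulrA -[leRHS]mulrA ler_pM2l//.
set e := enorm (x - y) in xy e0 *.
apply: (@le_trans _ _ ((e `^ a)^-1 * (delta x * delta y / e ^+ 2) `^ gamma)).
  rewrite ler_wpM2l ?invr_ge0 ?powR_ge0//.
  apply: ge0_ler_powR; rewrite ?nnegrE ?(ltW g0)//.
  - by rewrite le_min ler01 andbT divr_ge0 ?sqr_ge0// mulr_ge0 ?ltW.
  - by rewrite divr_ge0 ?sqr_ge0// mulr_ge0 ?ltW.
  - by rewrite ge_min lexx.
rewrite powRM ?invr_ge0 ?sqr_ge0 ?mulr_ge0 ?(ltW dx) ?(ltW dy)//.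
rewrite (powRM _ (ltW dx) (ltW dy)) -powR_mulrn ?(ltW e0)//.
have -> : ((e `^ 2)^-1) `^ gamma = e `^ (- (2 * gamma)).
  by rewrite -powRN -powRrM mulNr.
rewrite -powRN [X in X <= _](_ : _ = delta x `^ gamma *
   (delta y `^ gamma * e `^ (- (a + 2 * gamma)))); last first.
  have -> : - (a + 2 * gamma) = - a + - (2 * gamma) by ring.
  rewrite (@powRD _ _ (- a)); last by apply/implyP => _; rewrite gt_eqF.
  ring.
rewrite [leRHS]mulrCA [leRHS]mulrA mulrC ler_pM2r ?powR_gt0//.
apply: (@le_trans _ _ (delta y `^ gamma * (delta y / 2) `^ (- (a + 2 * gamma)))).
  rewrite ler_pM2l ?powR_gt0// !powRN lef_pV2 ?posrE ?powR_gt0 ?divr_gt0//.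
  apply: ge0_ler_powR; rewrite ?nnegrE ?(ltW e0) ?divr_ge0 ?(ltW dy)//.
  by rewrite addr_ge0// mulr_ge0// ltW.
rewrite powRM ?(ltW dy)// mulrA -powRD; last by apply/implyP => _; rewrite gt_eqF.
rewrite -(@powR_inv1 _ 2)// -powRrM mulrNN mul1r ler_pM2r ?powR_gt0//.
by rewrite /boundary_weight; have -> : gamma - (a + 2 * gamma) = 2 * s - n%:R - gamma by rewrite /a; ring.
Qed.

End green_kernel_bounds.

(** * Cells of the boundary and mollifiers supported in nearby balls *)

Section boundary_mollifiers.
Context (R : realType) (n : nat) (Omega : set 'rV[R]_n).
Hypotheses (Oopen : open Omega) (Obdd : bounded_set Omega).
Hypothesis D0 : boundary Omega !=set0.
Local Notation delta := (delta Omega).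
Local Notation D := (boundary Omega).

Let cball (a : 'rV[R]_n) (r : R) : set 'rV[R]_n := [set y | `|a - y| <= r].

Lemma leb_norm_ball_gt0 (a : 'rV[R]_n) r : 0 < r -> (0 < leb R n (cball a r))%E.
Proof.
move=> r0; have ab i : (a - const_mx r) 0 i <= (a + const_mx r) 0 i.
  by rewrite !mxE; lra.
have sub : rbox (a - const_mx r) (a + const_mx r) `<=` cball a r.
  move=> y h; apply: norm_le_coord => [|i]; first exact: ltW.
  by have := h i; rewrite !mxE ler_norml; lra.
apply: (@lt_le_trans _ _ (leb R n (rbox (a - const_mx r) (a + const_mx r)))); last first.
  exact: le_outer_measure.
apply: lt_le_trans (leb_rbox_ge ab); rewrite lte_fin; apply: prodr_gt0 => i _.
by rewrite !mxE; lra.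
Qed.

Lemma compact_cball (a : 'rV[R]_n) r : 0 < r -> compact (cball a r).
Proof.
move=> r0; apply: bounded_closed_compact.
  exists (`|a| + r); split; first exact: num_real.
  move=> N /ltW aN y /= ay; apply: le_trans aN.
  by rewrite -(subKr a y) (le_trans (ler_normB _ _))// lerD2l.
have -> : cball a r = (fun y => `|a - y|) @^-1` [set t | t <= r] by [].
apply: closed_comp; last exact: closed_le.
by move=> y _; exact: continuous_dist.
Qed.

(** Compactness covers the boundary by finitely many balls of radius [e / 3] around points [z_ i],
    which [seqDU] makes disjoint. As [z_ i] is in the closure of [Omega], a small ball inside
    [Omega] has its centre within [e / 3]. Three steps of at most [e / 3] join a point of the cell,
    [z_ i], the inner centre and a point of the inner ball. *)
Lemma boundary_cells (e : R) : 0 < e ->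
  exists (N : nat) (A : nat -> set 'rV[R]_n) (a : nat -> 'rV[R]_n) (r : nat -> R),
  [/\ trivIset setT A, forall i, measurable (A i : set (surf_space R n)),
      forall z, D z -> exists2 i, (i < N)%N & A i z,
      forall i, (i < N)%N -> 0 < r i /\ cball (a i) (r i) `<=` Omega &
      forall i z y, (i < N)%N -> A i z -> cball (a i) (r i) y -> `|z - y| < e].
Proof.
move=> e0; pose P z (p : 'rV[R]_n * R) := D z ->
  [/\ `|z - p.1| < e / 3, 0 < p.2, p.2 <= e / 3 & cball p.1 p.2 `<=` Omega].
have e3 : 0 < e / 3 by rewrite divr_gt0.
have ex z : exists p, P z p.
  have [Dz|Dz] := pselect (D z); last by exists (0, 0).
  have [|x [Ox]] := (proj1 Dz) (ball z (e / 3)); first exact: nbhsx_ballx.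
  rewrite -ball_normE /= => zx.
  have /nbhs_ballP[t /= t0 tO] : nbhs x Omega by exact: open_nbhs_nbhs.
  (* Halving [t] fits the closed ball into the open ball of radius [t]. *)
  exists (x, Num.min (t / 2) (e / 3)) => _; split => //=.
  - by rewrite lt_min e3 divr_gt0.
  - by rewrite ge_min lexx orbT.
  - move=> y /= xy; apply: tO; rewrite -ball_normE /=.
    apply: le_lt_trans xy _; rewrite gt_min; apply/orP; left; lra.
have [p hp] := choice ex.
have := compact_boundary Obdd; rewrite compact_cover => cov.
have [| |X XD Xcov] := cov 'rV[R]_n D (fun z => ball z (e / 3)).
- by move=> z _; exact: ball_open.
- by move=> z Dz; exists z => //; exact: ballxx.
pose xs : seq 'rV[R]_n := finmap.enum_fset X; pose z_ i := nth 0 xs i.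
pose U i := ball (z_ i) (e / 3).
have Dz_ i : (i < size xs)%N -> D (z_ i).
  by move=> iN; have := XD _ (mem_nth 0 iN); rewrite inE.
have mU i : measurable (U i : set (surf_space R n)).
  by apply: hausdorff_open_measurable; exact: ball_open.
exists (size xs), (seqDU U), (fun i => (p (z_ i)).1), (fun i => (p (z_ i)).2).
split.
- exact: trivIset_seqDU.
- move=> i; apply: (@measurableD _ (surf_space R n)); first exact: mU.
  by apply: (@bigsetU_measurable _ (surf_space R n)) => k _; exact: mU.
- move=> z Dz; have [z' z'X zz'] := Xcov _ Dz.
  have : (\big[setU/set0]_(i < size xs) U i) z.
    rewrite -bigcup_mkord; exists (index z' xs) => /=.
      by rewrite index_mem.
    by rewrite /U /z_ nth_index.
  by rewrite bigsetU_seqDU -bigcup_mkord => -[i /= iN Ai]; exists i.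
- by move=> i /Dz_ /hp[].
- move=> i z y iN Ai ay; have := @subset_seqDU _ U i z Ai.
  rewrite /U -ball_normE /= => zz.
  have [h1 h2 h3 _] := hp _ (Dz_ _ iN).
  rewrite -(subrKA (z_ i)) -(subrKA (p (z_ i)).1 (z_ i)).
  rewrite (le_lt_trans (ler_normD _ _))//.
  have := ler_normD (z_ i - (p (z_ i)).1) ((p (z_ i)).1 - y).
  have := le_trans ay h3; rewrite (distrC z); lra.
Qed.

(* [kap z] is [1_(B_i) / (|B_i| delta^gamma)] for the cell [A_i] of [z]. *)
Lemma boundary_mollifier (gamma e : R) : 0 <= gamma -> 0 < e ->
  exists (kap : 'rV[R]_n -> 'rV[R]_n -> R) (W : 'rV[R]_n -> R) (M : R),
  [/\ measurable_fun (D `*` Omega : set (surf_space R n * leb_space R n)%type)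
        (fun p => kap p.1 p.2),
      forall z y, 0 <= kap z y <= W y,
      forall y, Omega y -> W y <= M &
      forall z (w : 'rV[R]_n -> R) l eps, D z ->
        measurable_fun (Omega : set (leb_space R n)) w ->
        (forall y, Omega y -> `|z - y| < e -> `|w y - l| <= eps) ->
        `|\int[leb R n]_(y in Omega) (kap z y * (w y * delta y `^ gamma)) - l| <= eps].
Proof.
move=> g0 e0; have [N [A [a [r [tA mA covA hB hAB]]]]] := boundary_cells e0.
pose B i := cball (a i) (r i).
pose m i : R := (fine (leb R n (B i)))^-1.
have m0 i : 0 <= m i by rewrite invr_ge0 fine_ge0.
pose b (i : nat) y : R := \1_(B i) y * (m i * delta y `^ (- gamma)).
have b0 i y : 0 <= b i y by rewrite mulr_ge0// mulr_ge0// powR_ge0.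
pose kap (z y : 'rV[R]_n) : R := \sum_(i < N) \1_(A i) z * b i y.
pose W y : R := \sum_(i < N) b i y.
(* Each closed ball [B i] is compact inside [Omega], hence at positive distance from the boundary,
   so [delta] to the power [- gamma] is bounded on it. *)
pose M : R := \sum_(i < N) m i * (set_dist (B i) D) `^ (- gamma).
have mB i : measurable (B i : set (leb_space R n)) by exact: measurable_norm_ball.
exists kap, W, M; split.
- apply: measurable_sum => i; apply: measurable_funTS; apply: measurable_funM.
    apply: (measurableT_comp _ measurable_fst).
    exact/(proj1 (@measurable_indicP _ (surf_space R n) R (A i)))/mA.
  apply: (measurableT_comp (f := b i : leb_space R n -> R) _ measurable_snd).
  apply: measurable_funM.
    exact/(proj1 (@measurable_indicP _ (leb_space R n) R (B i)))/mB.
  apply: measurable_funM; first exact: measurable_cst.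
  apply: (measurableT_comp (measurable_powR _)).
  apply: continuous_measurable_leb; exact: delta_continuous.
- move=> z y; rewrite sumr_ge0/= => [|i _]; last by rewrite mulr_ge0.
  apply: ler_sum => i _; rewrite ler_piMl// indicE; exact: lern1_bool.
- move=> y Oy; apply: ler_sum => i _; rewrite /b indicE.
  have [yB|yB] := boolP (y \in B i); last first.
    by rewrite mul0r mulr_ge0 ?m0// powR_ge0.
  rewrite mul1r ler_wpM2l// !powRN; rewrite inE in yB.
  have [ri BO] := hB i (ltn_ord i).
  have d0 : 0 < set_dist (B i) D.
    apply: set_dist_gt0 => //; first by exists y.
    by split; [exact: compact_cball|exact: BO].
  have dy := set_dist_le_delta D0 yB.
  rewrite lef_pV2 ?posrE ?powR_gt0 ?(lt_le_trans d0 dy)//.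
  by apply: ge0_ler_powR => //; rewrite nnegrE ltW// (lt_le_trans d0).
move=> z w l eps Dz mw wl; have [i iN Aiz] := covA z Dz.
have [ri BO] := hB i iN.
(* The cells are disjoint, so only the one containing [z] contributes. *)
have kapE y : kap z y = b i y.
  rewrite /kap (bigD1 (Ordinal iN))//= indicE mem_set// mul1r big1 ?addr0// => j ji.
  rewrite indicE memNset ?mul0r// => Ajz.
  have /trivIsetP/(_ j i I I) := tA; rewrite -val_eqE/= in ji => /(_ ji).
  by apply/eqP/set0P; exists z.
have mBi : measurable (B i : set (leb_space R n)) := mB i.
have Bpos : (0 < leb R n (B i))%E by exact: leb_norm_ball_gt0.
have Bfin : (leb R n (B i) < +oo)%E.
  by apply: le_lt_trans (leb_norm_ball _ (ltW ri)) (ltry _).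
have mwB : measurable_fun (B i : set (leb_space R n)) w.
  by apply: measurable_funS mw; [exact: lebesgue_open_measurable|exact: BO].
have wlB y : B i y -> `|w y - l| <= eps.
  by move=> By; apply: wl; [exact: BO|exact: hAB iN Aiz By].
have iw : (leb R n).-integrable (B i) (EFin \o w).
  apply: (bounded_integrable (M := eps + `|l|) mBi Bfin mwB) => y By.
  by rewrite -[w y](subrK l) (le_trans (ler_normD _ _))// lerD2r wlB.
(* The powers of [delta] cancel, leaving the mean value of [w] over [B i]. *)
have -> : \int[leb R n]_(y in Omega) (kap z y * (w y * delta y `^ gamma)) =
    m i * \int[leb R n]_(y in B i) w y.
  rewrite -(RintegralZl _ mBi iw).
  have IB : Omega `&` B i = B i by apply: setIidr; exact: BO.
  rewrite -[in RHS]IB Rintegral_mkcondr.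
  apply: eq_Rintegral => y; rewrite inE => Oy; rewrite kapE /b indicE patchE.
  case: ifPn => yB; last by rewrite !mul0r.
  have dg : delta y `^ gamma != 0 by rewrite gt_eqF// powR_gt0// delta_gt0.
  by rewrite mul1r powRN -mulrA; congr (_ * _); rewrite mulrCA mulVf// mulr1.
exact: (average_close mBi Bpos Bfin mwB wlB).
Qed.

End boundary_mollifiers.

(** * Boundary behaviour and the Poisson integral *)

#[local] Instance leb_ae_filter (R : realType) (n : nat) :
  Filter (nbhs (almost_everywhere (leb R n))) := ae_filter_ringOfSetsType (leb R n).

Section boundary_behaviour.
Context (R : realType) (n : nat) (Omega : set 'rV[R]_n).
Hypotheses (n0 : (0 < n)%N) (Oopen : open Omega) (Obdd : bounded_set Omega).
Hypothesis D0 : boundary Omega !=set0.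
Context (s gamma : R) (G DG : 'rV[R]_n -> 'rV[R]_n -> R).
Hypothesis hG : green_kernel Omega s gamma G.
Hypothesis hDG : normal_derivative_kernel Omega gamma G DG.
Local Notation delta := (delta Omega).
Local Notation D := (boundary Omega).
Local Notation rho := (boundary_weight Omega s gamma).
Variables (C : R) (C0 : 0 < C).
Hypothesis hC : forall x y, Omega x -> Omega y -> delta y / 2 <= enorm (x - y) ->
    0 <= G x y / delta x `^ gamma <= C * rho y.

Let mO : measurable (Omega : set (leb_space R n)).
Proof. exact: lebesgue_open_measurable. Qed.

Let mD : measurable (D : set (surf_space R n)).
Proof.
rewrite -[D]setCK; apply: measurableC; apply: hausdorff_open_measurable.
exact/closed_openC/closed_boundary.
Qed.

Let Ofin : (leb R n Omega < +oo)%E.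
Proof. exact: leb_bounded_ltoo. Qed.

Lemma rho_ge0 y : 0 <= rho y. Proof. exact: powR_ge0. Qed.

Lemma exponent_lt0 : 2 * s - n%:R - gamma < 0.
Proof.
have [/andP[_ /andP[g0 _]] sn _ _ _] := hG.
by rewrite subr_lt0; apply: le_lt_trans g0; rewrite subr_le0.
Qed.

Lemma weight_antitone d e : 0 < d -> d <= e ->
  e `^ (2 * s - n%:R - gamma) <= d `^ (2 * s - n%:R - gamma).
Proof.
move=> d0 de; have e0 : 0 < e by exact: lt_le_trans de.
rewrite -[_ - gamma]opprK !(powRN _ (- _)) lef_pV2 ?posrE ?powR_gt0//.
by apply: ge0_ler_powR; rewrite ?nnegrE ?oppr_ge0 ?(ltW exponent_lt0) ?(ltW d0) ?(ltW e0).
Qed.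

Lemma measurable_rho : measurable_fun setT (rho : leb_space R n -> R).
Proof.
apply: (measurableT_comp (measurable_powR _)).
apply: continuous_measurable_leb; exact: delta_continuous.
Qed.

(** Since [delta y <= |y - z|], a point [x] close enough to [z] keeps the distance [delta y / 2]
    from [y], as [green_normalized_bound] requires. The factor [n] passes from the sup norm to the
    Euclidean one. *)
Lemma near_boundary_dist z x y : D z -> n%:R * `|x - z| <= delta y / 2 ->
  delta y / 2 <= enorm (x - y).
Proof.
move=> Dz h; have h1 := delta_le y Dz.
have h2 : enorm (y - z) <= enorm (x - y) + n%:R * `|x - z|.
  rewrite -(subrKA x) (enormB x y); apply: le_trans (enormD _ _) _.
  by rewrite lerD2l enorm_le_norm.
lra.
Qed.

Lemma boundary_sequence z : D z -> exists2 x_ : nat -> 'rV[R]_n,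
  (forall j, Omega (x_ j)) & x_ @ \oo --> z.
Proof.
move=> [cz _]; have h (j : nat) : exists x, Omega x /\ `|z - x| < j.+1%:R^-1.
  have [|x [Ox]] := cz (ball z j.+1%:R^-1).
    by apply: nbhsx_ballx; rewrite invr_gt0 ltr0n.
  by rewrite -ball_normE; exists x.
have [x_ hx] := choice h; exists x_ => [j|]; first by have [] := hx j.
apply/cvgrPdist_lt => e e0.
by apply: filterS (near_infty_natSinv_lt (PosNum e0)) => j; apply: lt_trans (proj2 (hx j)).
Qed.

(* [DG] satisfies the kernel bound only almost everywhere. *)
Definition truncated_DG (z y : 'rV[R]_n) : R :=
  Num.max 0 (Num.min (DG z y) (C * rho y)).

Lemma truncated_DG_bounds z y : 0 <= truncated_DG z y <= C * rho y.
Proof.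
have Cr : 0 <= C * rho y by rewrite mulr_ge0 ?rho_ge0// ltW.
by rewrite le_max lexx/= ge_max Cr ge_min lexx orbT.
Qed.

Lemma measurable_DG : measurable_fun
  (D `*` Omega : set (surf_space R n * leb_space R n)%type)
  (fun p => DG p.1 p.2).
Proof. exact: (proj1 hDG). Qed.

Lemma measurable_truncated_DG : measurable_fun
  (D `*` Omega : set (surf_space R n * leb_space R n)%type)
  (fun p => truncated_DG p.1 p.2).
Proof.
apply: measurable_maxr => //; apply: measurable_minr; first exact: measurable_DG.
apply: measurable_funM => //; apply: measurable_funTS.
exact: (measurableT_comp measurable_rho measurable_snd).
Qed.

(** Along one sequence tending to [z], the normalized kernel at a given [y] eventually lies in the
    truncation range, and so does its limit, which is [DG z y] for almost every [y]. *)
Lemma truncated_DG_ae z : D z ->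
  \forall y \ae leb R n, Omega y -> truncated_DG z y = DG z y.
Proof.
move=> Dz; have [x_ Ox xz] := boundary_sequence Dz.
have := proj2 hDG z x_ Dz Ox xz; apply: filterS => y h Oy.
have cv := h Oy; have dy : 0 < delta y by exact: delta_gt0.
have near_bd : \forall j \near \oo, 0 <= G (x_ j) y / delta (x_ j) `^ gamma <= C * rho y.
  have e0 : 0 < delta y / 2 / n.+1%:R by rewrite !divr_gt0// ltr0n.
  have /cvgrPdist_lt/(_ _ e0) := xz; apply: filterS => j xj.
  apply: hC => //; apply: (near_boundary_dist Dz).
  move: xj; rewrite ltr_pdivlMr ?ltr0n// distrC => /ltW; apply: le_trans.
  by rewrite mulrC ler_wpM2l// ler_nat.
have DG0 : 0 <= DG z y.
  by apply: cvgr_to_ge cv _; apply: filterS near_bd => j /andP[].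
have DG1 : DG z y <= C * rho y.
  by apply: cvgr_to_le cv _; apply: filterS near_bd => j /andP[].
by rewrite /truncated_DG (min_idPl DG1) (max_idPr DG0).
Qed.

(** Compact support enters the estimates through [d]: where [psi] is nonzero, [rho] is at most [d]
    to the same negative power. *)
Lemma Linfty_c_bounds psi : Linfty_c Omega psi -> exists B d : R,
  [/\ 0 <= B, 0 < d, forall y, Omega y -> `|psi y| <= B &
      forall y, Omega y -> psi y != 0 -> d <= delta y].
Proof.
move=> [[mpsi [B psiB]] [K [cK KO] psi0]].
have B0 (y : 'rV[R]_n) : Omega y -> `|psi y| <= Num.max B 0.
  by move=> /psiB h; rewrite le_max h.
have [K0|/set0P Kn0] := eqVneq K set0.
  exists (Num.max B 0), 1; split => //; first by rewrite le_max lexx orbT.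
  by move=> y Oy; rewrite psi0 ?eqxx// K0.
exists (Num.max B 0), (set_dist K D); split => //.
- by rewrite le_max lexx orbT.
- exact: set_dist_gt0.
- move=> y Oy; have [Ky _|Ky] := pselect (K y); first exact: set_dist_le_delta.
  by rewrite psi0 ?eqxx.
Qed.

Lemma green_integrand_integrable x psi : Omega x -> Linfty Omega psi ->
  (leb R n).-integrable Omega (fun y => (G x y * psi y)%:E).
Proof.
move=> Ox [mpsi [B psiB]].
have [M M0 hM] := green_mass n0 Oopen Obdd hG.
have mGx := green_slice_measurable Oopen hG Ox.
apply: (le_integrable mO (g := fun y => (B%:E * (G x y)%:E)%E)).
- by apply/measurable_EFinP; exact: measurable_funM.
- move=> y Oy; rewrite lee_fin !normrM mulrC ler_wpM2r//.
  by apply: le_trans (psiB _ Oy) _; exact: ler_norm.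
- apply: integrableZl => //; apply/integrableP; split.
    exact/measurable_EFinP.
  by apply: le_lt_trans (hM _ Ox) (ltry _).
Qed.

(** [DG] is characterized along sequences, with a null set depending on the sequence. A failure of
    the limit is therefore turned into a sequence [x_] staying [e] away from [l], which dominated
    convergence refutes. *)
Lemma green_op_boundary_limit psi z : Linfty_c Omega psi -> D z ->
  green_op Omega G psi x / delta x `^ gamma @[x --> within Omega (nbhs z)] -->
  \int[leb R n]_(y in Omega) (DG z y * psi y).
Proof.
move=> hpsi Dz; have [B [d [B0 d0 psiB psid]]] := Linfty_c_bounds hpsi.
set l := \int[leb R n]_(y in Omega) _; have [[mpsi _] _] := hpsi.
pose w x := green_op Omega G psi x / delta x `^ gamma.
apply/cvgrPdist_lt => e e0; apply: contrapT => H.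
(* The factor [d / 2 / n.+1%:R] brings every [x_ k] so close to [z] that the kernel bound holds on
   the support of [psi] from the first index on; the factor [1 / k.+1] forces convergence. *)
pose eta (k : nat) : R := d / 2 / n.+1%:R / k.+1%:R.
have eta0 k : 0 < eta k by rewrite !divr_gt0// ltr0n.
have ex k : exists x, [/\ Omega x, `|z - x| < eta k & e <= `|l - w x|].
  apply: contrapT => /forallNP nex; apply: H.
  rewrite nearE /within /=; apply/nbhs_ballP; exists (eta k) => //=.
  move=> x; rewrite -ball_normE /= => zx Ox; rewrite ltNge; apply/negP => h.
  exact: (nex x).
have [x_ hx] := choice ex.
have Ox k : Omega (x_ k) by have [] := hx k.
have eta_le k : eta k <= d / 2 / n.+1%:R.
  by rewrite ler_pdivrMr ?ltr0n// ler_peMr ?ler1n// !divr_ge0// ltW.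
have xz : x_ @ \oo --> z.
  apply/cvgrPdist_lt => r r0; have r1 : 0 < r / (d / 2 / n.+1%:R).
    by rewrite !divr_gt0// ltr0n.
  apply: filterS (near_infty_natSinv_lt (PosNum r1)) => k /=.
  have [_ zx _] := hx k; rewrite ltr_pdivlMr ?divr_gt0 ?ltr0n// mulrC.
  exact: lt_trans.
have near_bd k y : Omega y -> psi y != 0 ->
    0 <= G (x_ k) y / delta (x_ k) `^ gamma <= C * rho y.
  move=> Oy py; apply: hC => //; apply: (near_boundary_dist Dz).
  have [_ zx _] := hx k; have dy := psid _ Oy py.
  have : `|x_ k - z| <= d / 2 / n.+1%:R.
    by rewrite distrC; apply: le_trans (ltW zx) (eta_le k).
  rewrite ler_pdivlMr ?ltr0n// => h; apply: (@le_trans _ _ (d / 2)); last first.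
    by rewrite ler_pM2r.
  by apply: le_trans h; rewrite mulrC ler_wpM2l// ler_nat.
pose M := C * d `^ (2 * s - n%:R - gamma) * B.
have dom k y : Omega y ->
    `|G (x_ k) y / delta (x_ k) `^ gamma * psi y| <= M.
  move=> Oy; have [->|py] := eqVneq (psi y) 0.
    by rewrite mulr0 normr0 !mulr_ge0 ?powR_ge0// ltW.
  have /andP[h1 h2] := near_bd k y Oy py.
  rewrite normrM (ger0_norm h1); apply: ler_pM => //; last exact: psiB.
  apply: le_trans h2 _; rewrite ler_pM2l//; apply: weight_antitone => //.
  exact: psid.
have mf k : measurable_fun (Omega : set (leb_space R n))
    (fun y => G (x_ k) y / delta (x_ k) `^ gamma * psi y).
  apply: measurable_funM; last exact: mpsi.
  apply: measurable_funM; last exact: measurable_cst.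
  exact: (green_slice_measurable Oopen hG).
have ml : measurable_fun (Omega : set (leb_space R n)) (fun y => DG z y * psi y).
  apply: measurable_funM; last exact: mpsi.
  exact: (@measurable_fun_slice1 _ _ (surf_space R n) (leb_space R n) R D Omega
    (fun z y => DG z y) mD mO measurable_DG z Dz).
have cvf : {ae leb R n, forall y, Omega y ->
    G (x_ k) y / delta (x_ k) `^ gamma * psi y @[k --> \oo] --> DG z y * psi y}.
  move: (proj2 hDG z x_ Dz Ox xz); apply: filterS => y h Oy.
  by apply: cvgM; [exact: h|exact: cvg_cst].
have iM : (leb R n).-integrable Omega (EFin \o cst M).
  by apply: (@bounded_integrable _ _ _ _ _ (cst M) `|M|).
have wE k : w (x_ k) = \int[leb R n]_(y in Omega)
    (G (x_ k) y / delta (x_ k) `^ gamma * psi y).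
  rewrite /w /green_op.
  rewrite -(RintegralZr _ mO (green_integrand_integrable (Ox k) (proj1 hpsi))).
  by apply: eq_Rintegral => y _; rewrite mulrAC.
have : w (x_ k) @[k --> \oo] --> l.
  under eq_fun do rewrite wE.
  exact: (dominated_Rintegral_cvg mO mf ml cvf iM dom).
move=> /cvgrPdist_lt/(_ _ e0)[k _ /(_ k (leqnn k))].
by have [_ _] := hx k; rewrite leNgt => /negP.
Qed.

Lemma measurable_truncated_slice z : D z ->
  measurable_fun (Omega : set (leb_space R n)) (truncated_DG z).
Proof.
move=> Dz; exact: (@measurable_fun_slice1 _ _ (surf_space R n) (leb_space R n)
  R D Omega (fun z y => truncated_DG z y) mD mO measurable_truncated_DG z Dz).
Qed.

Lemma normal_derivativeE psi z : Linfty_c Omega psi -> D z ->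
  normal_derivative Omega gamma (green_op Omega G psi) z =
  \int[leb R n]_(y in Omega) (DG z y * psi y).
Proof.
move=> hpsi Dz; have lim := green_op_boundary_limit hpsi Dz.
have PF : ProperFilter (within Omega (nbhs z)).
  by apply: within_nbhs_proper; have [] := Dz.
by rewrite /normal_derivative (cvg_lim (@Rhausdorff R) lim).
Qed.

Lemma normal_derivative_green_op psi z : Linfty_c Omega psi -> D z ->
  normal_derivative Omega gamma (green_op Omega G psi) z =
  \int[leb R n]_(y in Omega) (truncated_DG z y * psi y).
Proof.
move=> hpsi Dz; have [[mpsi _] _] := hpsi; rewrite normal_derivativeE//.
apply: (ae_eq_Rintegral mO).
- apply: measurable_funM; last exact: mpsi.
  exact: (@measurable_fun_slice1 _ _ (surf_space R n) (leb_space R n) R D Omega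
    (fun z y => DG z y) mD mO measurable_DG z Dz).
- apply: measurable_funM; last exact: mpsi.
  exact: measurable_truncated_slice.
- by apply: filterS (truncated_DG_ae Dz) => y h Oy; rewrite h.
Qed.

(** The solution. With the truncated kernel, the integral converges and the pointwise bound holds at
    every [y] in [Omega]. *)
Definition poisson (h : 'rV[R]_n -> R) (y : 'rV[R]_n) : R :=
  \int[surf R n]_(z in D) (truncated_DG z y * h z).

Lemma poisson_bound h y : L1_bnd Omega h -> Omega y -> (`|(poisson h y)%:E| <=
  (C * rho y)%:E * \int[surf R n]_(z in D) `|(h z)%:E|)%E.
Proof.
move=> hh Oy; exact: (@kernel_integral_bound _ _ (surf_space R n) (leb_space R n)
  R (surf R n) D Omega (fun z y => truncated_DG z y) mD mO measurable_truncated_DG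
  (fun y => C * rho y) truncated_DG_bounds h hh y Oy).
Qed.

Lemma poisson_dual h psi : L1_bnd Omega h -> Linfty_c Omega psi ->
  (leb R n).-integrable Omega (fun y => (poisson h y * psi y)%:E) /\
  (\int[leb R n]_(y in Omega) (poisson h y * psi y)%:E =
   \int[surf R n]_(z in D)
     (h z * normal_derivative Omega gamma (green_op Omega G psi) z)%:E)%E.
Proof.
move=> hh hpsi; have [B [d [B0 d0 psiB psid]]] := Linfty_c_bounds hpsi.
have [[mpsi _] _] := hpsi.
pose M := C * d `^ (2 * s - n%:R - gamma) * B.
have kM z y : D z -> Omega y -> `|truncated_DG z y * psi y| <= M.
  move=> _ Oy; have [->|py] := eqVneq (psi y) 0.
    by rewrite mulr0 normr0 !mulr_ge0 ?powR_ge0// ltW.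
  have /andP[t0 t1] := truncated_DG_bounds z y.
  rewrite normrM (ger0_norm t0); apply: ler_pM => //; last exact: psiB.
  apply: le_trans t1 _; rewrite ler_pM2l//; apply: weight_antitone => //.
  exact: psid.
have [ip eqp] := @kernel_duality _ _ (surf_space R n) (leb_space R n)
  R (surf R n) (leb R n) (leb_sigma_finite R n) D Omega
  (fun z y => truncated_DG z y) mD mO Ofin measurable_truncated_DG
  (fun y => C * rho y) truncated_DG_bounds h hh psi M mpsi kM.
split; first exact: ip.
rewrite [LHS]eqp; apply: eq_integral => z; rewrite inE => Dz.
by rewrite (normal_derivative_green_op hpsi Dz).
Qed.

Lemma poisson_representation h : L1_bnd Omega h ->
  \forall y \ae leb R n, Omega y ->
  ((poisson h y)%:E = \int[surf R n]_(z in D) (DG z y * h z)%:E)%E.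
Proof.
move=> hh; exact: (@kernel_integral_ae _ _ (surf_space R n) (leb_space R n)
  R (surf R n) (leb R n) (leb_sigma_finite R n) D Omega
  (fun z y => truncated_DG z y) mD mO measurable_truncated_DG
  (fun y => C * rho y) truncated_DG_bounds h hh (fun z y => DG z y)
  measurable_DG truncated_DG_ae).
Qed.

Lemma compact_measurable_leb K : compact K -> measurable (K : set (leb_space R n)).
Proof.
by move=> cK; apply: lebesgue_closed_measurable; exact: (compact_closed (@norm_hausdorff _ _) cK).
Qed.

Lemma Linfty_c_restrict K phi : compact_in Omega K -> Linfty K phi ->
  Linfty_c Omega (phi \_ K).
Proof.
move=> cK [mphi [B phiB]]; have mK := compact_measurable_leb (proj1 cK); split.
  split.
    apply: measurable_funTS.
    exact: (proj1 (@measurable_restrictT _ _ (leb_space R n) _ K phi mK) mphi).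
  exists (Num.max B 0) => x _; rewrite patchE; case: ifPn => [|_].
    by rewrite inE => /phiB h'; rewrite le_max h'.
  by rewrite normr0 le_max lexx orbT.
by exists K => // x _ Kx; rewrite patchE memNset.
Qed.

Lemma integral_restrict_test K phi (v : 'rV[R]_n -> R) : compact_in Omega K ->
  (\int[leb R n]_(x in Omega) (v x * (phi \_ K) x)%:E =
   \int[leb R n]_(x in K) (v x * phi x)%:E)%E.
Proof.
move=> [cK KO]; rewrite integral_mkcond [RHS]integral_mkcond.
apply: eq_integral => x _; rewrite !patchE.
have [xK|xK] := boolP (x \in K).
  by rewrite mem_set//; apply: KO; rewrite inE in xK.
by rewrite mulr0; case: ifP.
Qed.

(** The duality lemma includes integrability against a test function; the indicator of [K] is
    one. *)
Lemma poisson_L1_loc h : L1_bnd Omega h -> L1_loc Omega (poisson h).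
Proof.
move=> hh K cK; have mK := compact_measurable_leb (proj1 cK).
have h1 : Linfty K (cst 1 : 'rV[R]_n -> R).
  by split; [exact: measurable_cst|exists 1 => x _; rewrite normr1].
have [ip _] := poisson_dual hh (Linfty_c_restrict cK h1).
have ipK := integrableS mO mK (proj2 cK) ip.
apply: eq_integrable ipK; first exact: mK.
by move=> x xK; rewrite patchE xK mulr1.
Qed.

Lemma poisson_weak_dual_solution h : L1_bnd Omega h ->
  weak_dual_solution Omega gamma G h (poisson h).
Proof. by move=> hh psi hpsi; have [_ ->] := poisson_dual hh hpsi. Qed.

Lemma poisson_Linfty_norm h K : L1_bnd Omega h -> compact_in Omega K ->
  ('N[leb R n]_+oo[EFin \o (poisson h \_ K)] <=
   (C * set_dist K D `^ (2 * s - n%:R - gamma))%:E *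
   \int[surf R n]_(z in D) `|(h z)%:E|)%E.
Proof.
move=> hh [cK KO]; set r := (_ * \int[_]_(_ in _) _)%E.
have r0 : (0 <= r)%E.
  apply: mule_ge0; last by apply: integral_ge0 => z _; exact: abse_ge0.
  by rewrite lee_fin mulr_ge0 ?powR_ge0// ltW.
(* The norm is 0 by definition when the whole space is null. The same [r0] settles the points
   outside [K], where the restriction vanishes. *)
rewrite unlock; case: ifP => [_|_]; last exact: r0.
apply/ess_supP; apply: aeW => x /=.
rewrite patchE; case: ifPn => [xK|_]; last by rewrite normr0; exact: r0.
rewrite inE in xK; apply: le_trans (poisson_bound hh (KO _ xK)) _.
apply: lee_wpmul2r; first by apply: integral_ge0 => z _; exact: abse_ge0.
rewrite lee_fin ler_pM2l//; apply: weight_antitone.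
  by apply: set_dist_gt0 => //; exists x.
exact: set_dist_le_delta.
Qed.

(** On the closure of [Omega], [delta] vanishes outside [Omega], so its superlevel sets at positive
    heights are closed, bounded and contained in [Omega]. *)
Lemma compact_exhaustion : exists2 K : nat -> set 'rV[R]_n,
  (forall k, compact_in Omega (K k)) & Omega `<=` \bigcup_k K k.
Proof.
exists (fun k => closure Omega `&` delta @^-1` [set r | k.+1%:R^-1 <= r]).
  move=> k; split; last first.
    move=> x [cx /= dx]; apply: contrapT => Ox.
    have Dx : D x by split => //; rewrite (proj1 (interior_id _) Oopen).
    have := delta_le x Dx; rewrite subrr => d0.
    have : 0 < k.+1%:R^-1 :> R by rewrite invr_gt0 ltr0n.
    rewrite ltNge => /negP; apply; apply: le_trans dx (le_trans d0 _).
    by apply: le_trans (enorm_le_norm _) _; rewrite normr0 mulr0.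
  apply: bounded_closed_compact.
    have [M [Mr hM]] := bounded_boundary Obdd.
    have [M' [Mr' hM']] := Obdd.
    exists (Num.max M M'); split; first exact: num_real.
    move=> N; rewrite gt_max => /andP[MN MN'] x [cx _].
    have [Ox|Ox] := pselect (Omega x); first exact: hM' Ox.
    by apply: (hM _ MN); split => //; rewrite (proj1 (interior_id _) Oopen).
  apply: closedI; first exact: closed_closure.
  apply: closed_comp; last exact: closed_ge.
  by move=> x _; exact: delta_continuous.
move=> x Ox; exists (Num.truncn (delta x)^-1) => //; split.
  exact: subset_closure.
have dx := delta_gt0 Oopen D0 Ox.
rewrite /= -[leRHS]invrK lef_pV2 ?posrE ?ltr0n ?invr_gt0//.
exact/ltW/truncnS_gt.
Qed.

Lemma weak_dual_solution_unique h u v : L1_loc Omega u -> L1_loc Omega v ->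
  weak_dual_solution Omega gamma G h u -> weak_dual_solution Omega gamma G h v ->
  \forall x \ae leb R n, Omega x -> v x = u x.
Proof.
move=> iu iv su sv; have [K cK OK] := compact_exhaustion.
have ae_k : {ae leb R n, forall x k, K k x -> v x = u x}.
  apply: ae_foralln => k; have mK := compact_measurable_leb (proj1 (cK k)).
  apply: (@ae_eq_of_clipped_test _ (leb_space R n) _ (leb R n) (K k) u v mK
    (iu _ (cK k)) (iv _ (cK k))) => phi mphi phi1.
  have Lphi : Linfty (K k) phi by split; [exact: mphi|exists 1 => x _; exact: phi1].
  have test := Linfty_c_restrict (cK k) Lphi.
  by rewrite -!(integral_restrict_test _ _ (cK k)) (su _ test) (sv _ test).
by apply: filterS ae_k => x hx /OK[k _]; exact: hx.
Qed.

Lemma delta_bounded : exists M : R, forall y, Omega y -> delta y <= M.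
Proof.
have [z Dz] := D0; have [M [_ hM]] := Obdd.
exists (n%:R * (`|M| + 1 + `|z|)) => y Oy; apply: le_trans (delta_le y Dz) _.
apply: le_trans (enorm_le_norm _) _; rewrite ler_wpM2l//.
apply: le_trans (ler_normB _ _) _; rewrite lerD2r; apply: hM => //.
by rewrite (le_lt_trans (ler_norm M))// ltrDl.
Qed.

(** The duality lemma with three tests: the constant 1 gives measurability of [f], the power of
    [delta] its weighted integrability, and [g] the identity. As [kap] is bounded on all of [Omega],
    the test [g] can be the Green potential of [psi], which does not have compact support. *)
Lemma mollified_dual (kap : 'rV[R]_n -> 'rV[R]_n -> R) (W : 'rV[R]_n -> R) (M : R)
    (h : 'rV[R]_n -> R) :
  measurable_fun (D `*` Omega : set (surf_space R n * leb_space R n)%type)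
    (fun p => kap p.1 p.2) ->
  (forall z y, 0 <= kap z y <= W y) -> (forall y, Omega y -> W y <= M) ->
  L1_bnd Omega h ->
  let f y := \int[surf R n]_(z in D) (kap z y * h z) in
  [/\ Linfty Omega f, L1_weighted Omega gamma f &
      forall g, Linfty Omega g -> \int[leb R n]_(y in Omega) (f y * g y) =
        \int[surf R n]_(z in D)
          (h z * \int[leb R n]_(y in Omega) (kap z y * g y))].
Proof.
move=> mk kW WM hh f.
have kgM (g : 'rV[R]_n -> R) (B : R) (gB : forall y, Omega y -> `|g y| <= B) z y :
    D z -> Omega y -> `|kap z y * g y| <= M * B.
  move=> _ Oy; have /andP[k0 k1] := kW z y.
  by rewrite normrM (ger0_norm k0) ler_pM ?gB// (le_trans k1) ?WM.
have duality (g : 'rV[R]_n -> R) (B : R)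
    (mg : measurable_fun (Omega : set (leb_space R n)) g)
    (gB : forall y, Omega y -> `|g y| <= B) :=
  @kernel_duality _ _ (surf_space R n) (leb_space R n) R (surf R n) (leb R n)
    (leb_sigma_finite R n) D Omega (fun z y => kap z y) mD mO Ofin mk W kW h hh
    g (M * B) mg (kgM g B gB).
have g0_ge0 : 0 <= gamma.
  by have [/andP[_ /andP[/ltW]]] := hG.
have one1 (y : 'rV[R]_n) : Omega y -> `|(cst 1 : 'rV[R]_n -> R) y| <= 1.
  by rewrite normr1.
have m1 : measurable_fun (Omega : set (leb_space R n)) (cst 1 : 'rV[R]_n -> R).
  exact: measurable_cst.
have [int1 _] := duality (cst 1) 1 m1 one1.
have mf : measurable_fun (Omega : set (leb_space R n)) f.
  apply/measurable_EFinP; apply: eq_measurable_fun (measurable_int _ int1) => y _.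
  by rewrite /= mulr1.
have [Md hMd] := delta_bounded.
pose dg y := delta y `^ gamma.
have mdg : measurable_fun (Omega : set (leb_space R n)) dg.
  apply: measurable_funTS; apply: (measurableT_comp (measurable_powR _)).
  by apply: continuous_measurable_leb; exact: delta_continuous.
have dgB y : Omega y -> `|dg y| <= Md `^ gamma.
  move=> Oy; rewrite ger0_norm ?powR_ge0//.
  apply: ge0_ler_powR => //; rewrite ?nnegrE ?delta_ge0 ?hMd//.
  exact: le_trans (delta_ge0 _ y) (hMd _ Oy).
have [intd _] := duality dg _ mdg dgB.
split.
- split=> //; exists (M * fine (\int[surf R n]_(z in D) `|(h z)%:E|)%E) => y Oy.
  have hfin : (\int[surf R n]_(z in D) `|(h z)%:E| \is a fin_num)%E.
    rewrite ge0_fin_numE; last by apply: integral_ge0 => z _; exact: abse_ge0.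
    by have /integrableP[] := hh.
  have := @kernel_integral_bound _ _ (surf_space R n) (leb_space R n)
    R (surf R n) D Omega (fun z y => kap z y) mD mO mk W kW h hh y Oy.
  move=> bd; rewrite -lee_fin [leRHS]EFinM (fineK hfin); apply: le_trans bd _.
  apply: lee_wpmul2r; first by apply: integral_ge0 => z _; exact: abse_ge0.
  by rewrite lee_fin WM.
- by split.
- move=> g [mg [B gB]]; have [_ e] := duality g B mg gB.
  exact: (congr1 fine e).
Qed.

Lemma LinftyP f : Linfty Omega f -> exists B : R,
  [/\ 0 <= B, measurable_fun (Omega : set (leb_space R n)) f &
      forall y, Omega y -> `|f y| <= B].
Proof.
move=> [mf [B fB]]; exists (Num.max B 0); split => //.
- by rewrite le_max lexx orbT.
- by move=> y /fB h; rewrite le_max h.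
Qed.

Let symG x y : Omega x -> Omega y -> G x y = G y x.
Proof. by have [_ _ _ h _] := hG; exact: h. Qed.

Let mG : measurable_fun (Omega `*` Omega : set (leb_space R n * leb_space R n)%type)
  (fun p => G p.1 p.2).
Proof. by have [] := hG. Qed.

Lemma green_op_Linfty f : Linfty Omega f -> Linfty Omega (green_op Omega G f).
Proof.
move=> /LinftyP[B [B0 mf fB]]; have [M M0 hM] := green_mass n0 Oopen Obdd hG.
split.
  exact: (@measurable_kernel_operator _ (leb_space R n) R (leb R n)
    (leb_sigma_finite R n) Omega (fun x y => G x y) M mO Ofin mG hM f B mf fB B0).
exists (B * M) => y Oy.
exact: (@kernel_operator_bound _ (leb_space R n) R (leb R n)
  Omega (fun x y => G x y) M mO mG hM f B mf fB y Oy B0).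
Qed.

Lemma green_op_L1_loc f : Linfty Omega f -> L1_loc Omega (green_op Omega G f).
Proof.
move=> /green_op_Linfty[mg [B gB]] K [cK KO].
have mK := compact_measurable_leb cK.
apply: (bounded_integrable (M := B) mK).
- by apply: le_lt_trans Ofin; exact: le_outer_measure.
- exact: measurable_funS mg.
- by move=> x /KO; exact: gB.
Qed.

Lemma green_op_symmetric f g : Linfty Omega f -> Linfty Omega g ->
  \int[leb R n]_(x in Omega) (green_op Omega G f x * g x) =
  \int[leb R n]_(x in Omega) (f x * green_op Omega G g x).
Proof.
move=> /LinftyP[Bf [Bf0 mf fB]] /LinftyP[Bg [Bg0 mg gB]].
have [M M0 hM] := green_mass n0 Oopen Obdd hG.
exact: (@kernel_operator_symmetric _ (leb_space R n) R (leb R n)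
    (leb_sigma_finite R n) Omega (fun x y => G x y) M mO Ofin mG symG hM
    f g Bf Bg Bf0 Bg0 mf mg fB gB).
Qed.

(** A bound uniform in the boundary point. It dominates the averages of [G(psi)] divided by the
    power of [delta], once the mollifying balls are within [eta] of the boundary. *)
Lemma green_op_near_boundary psi : Linfty_c Omega psi ->
  exists eta M : R, [/\ 0 < eta, 0 <= M &
    forall z y, D z -> Omega y -> `|z - y| < eta ->
      `|green_op Omega G psi y / delta y `^ gamma| <= M].
Proof.
move=> hpsi; have [B [d [B0 d0 psiB psid]]] := Linfty_c_bounds hpsi.
have [[mpsi _] _] := hpsi.
pose M := C * d `^ (2 * s - n%:R - gamma) * B.
have M0 : 0 <= M by rewrite !mulr_ge0 ?powR_ge0// ltW.
have vol0 : 0 <= fine (leb R n Omega) by exact/fine_ge0/measure_ge0.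
exists (d / 2 / n.+1%:R), (M * fine (leb R n Omega)); split.
- by rewrite !divr_gt0// ltr0n.
- by rewrite mulr_ge0.
move=> z y Dz Oy zy.
have dom x : Omega x -> `|G y x / delta y `^ gamma * psi x| <= M.
  move=> Ox; have [->|px] := eqVneq (psi x) 0; first by rewrite mulr0 normr0.
  have dx := psid _ Ox px.
  have /andP[h1 h2] : 0 <= G y x / delta y `^ gamma <= C * rho x.
    apply: hC => //; apply: (near_boundary_dist Dz).
    have := ltW zy; rewrite distrC ler_pdivlMr ?ltr0n// => h.
    apply: (@le_trans _ _ (d / 2)); last by rewrite ler_pM2r.
    by apply: le_trans h; rewrite mulrC ler_wpM2l// ler_nat.
  rewrite normrM (ger0_norm h1); apply: ler_pM => //; last exact: psiB.
  apply: le_trans h2 _; rewrite ler_pM2l//; exact: weight_antitone.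
have mi : measurable_fun (Omega : set (leb_space R n))
    (fun x => G y x / delta y `^ gamma * psi x).
  apply: measurable_funM; last exact: mpsi.
  apply: measurable_funM; last exact: measurable_cst.
  exact: (green_slice_measurable Oopen hG).
have ii := bounded_integrable mO Ofin mi dom.
have -> : green_op Omega G psi y / delta y `^ gamma =
    \int[leb R n]_(x in Omega) (G y x / delta y `^ gamma * psi x).
  rewrite /green_op -(RintegralZr _ mO (green_integrand_integrable Oy (proj1 hpsi))).
  by apply: eq_Rintegral => x _; rewrite mulrAC.
apply: le_trans (le_normr_Rintegral mO ii) _.
rewrite -(Rintegral_cst (leb R n) mO); apply: (le_Rintegral mO).
- rewrite (_ : EFin \o _ = (fun x => `|(G y x / delta y `^ gamma * psi x)%:E|%E))//.
  exact: integrable_abse.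
- by apply: (@bounded_integrable _ _ _ _ _ (cst M) `|M|).
- exact: dom.
Qed.

Lemma poisson_approximation h : L1_bnd Omega h ->
  exists f_ : nat -> 'rV[R]_n -> R,
    (forall j, L1_weighted Omega gamma (f_ j)) /\
    weak_cvg_L1_loc Omega (fun j => green_op Omega G (f_ j)) (poisson h).
Proof.
move=> hh; have [/andP[_ /andP[gamma0 _]] _ _ _ _] := hG.
have ej0 (j : nat) : 0 < j.+1%:R^-1 :> R by rewrite invr_gt0 ltr0n.
have [kap hkap] := choice (fun j => boundary_mollifier Oopen Obdd D0 (ltW gamma0) (ej0 j)).
have [W hW] := choice hkap; have [M hM] := choice hW => {hkap hW}.
pose f_ j y := \int[surf R n]_(z in D) (kap j z y * h z).
have dual j : [/\ Linfty Omega (f_ j), L1_weighted Omega gamma (f_ j) &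
    forall g, Linfty Omega g -> \int[leb R n]_(y in Omega) (f_ j y * g y) =
        \int[surf R n]_(z in D)
          (h z * \int[leb R n]_(y in Omega) (kap j z y * g y))].
  have [mk kW WM _] := hM j; exact: mollified_dual mk kW WM hh.
exists f_; split => [j|]; first by have [] := dual j.
split => [j||K phi cK Lphi].
- by apply: green_op_L1_loc; have [] := dual j.
- exact: poisson_L1_loc.
pose psi := phi \_ K; have tpsi : Linfty_c Omega psi := Linfty_c_restrict cK Lphi.
have Lpsi := proj1 tpsi.
have restr (v : 'rV[R]_n -> R) : \int[leb R n]_(x in K) (v x * phi x) =
    \int[leb R n]_(x in Omega) (v x * psi x).
  exact: (esym (congr1 fine (integral_restrict_test _ _ cK))).
pose g := green_op Omega G psi; have Lg : Linfty Omega g := green_op_Linfty Lpsi.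
pose nd z := normal_derivative Omega gamma g z.
pose Mo j z := \int[leb R n]_(y in Omega) (kap j z y * g y).
have lhs j : \int[leb R n]_(x in K) (green_op Omega G (f_ j) x * phi x) =
    \int[surf R n]_(z in D) (h z * Mo j z).
  have [Lf _ df] := dual j.
  by rewrite restr (green_op_symmetric Lf Lpsi) (df g Lg).
have rhs : \int[leb R n]_(x in K) (poisson h x * phi x) =
    \int[surf R n]_(z in D) (h z * nd z).
  by rewrite restr; exact: (congr1 fine (proj2 (poisson_dual hh tpsi))).
rewrite rhs (_ : (fun j => _) = (fun j => \int[surf R n]_(z in D) (h z * Mo j z))); last first.
  by apply/funext => j; exact: lhs.
have [eta [B [eta0 B0 nearB]]] := green_op_near_boundary tpsi.
pose w y := g y / delta y `^ gamma.
have mw : measurable_fun (Omega : set (leb_space R n)) w.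
  rewrite (_ : w = fun y => g y * delta y `^ (- gamma)); last first.
    by apply/funext => y; rewrite powRN.
  apply: measurable_funM; first exact: (proj1 Lg).
  apply: measurable_funTS; apply: (measurableT_comp (measurable_powR _)).
  by apply: continuous_measurable_leb; exact: delta_continuous.
have Mo_close j z l eps : D z ->
    (forall y, Omega y -> `|z - y| < j.+1%:R^-1 -> `|w y - l| <= eps) ->
    `|Mo j z - l| <= eps.
  move=> Dz wl; have [_ _ _ close] := hM j.
  have -> : Mo j z = \int[leb R n]_(y in Omega)
      (kap j z y * (w y * delta y `^ gamma)).
    apply: eq_Rintegral => y; rewrite inE => Oy.
    by rewrite /w divfK// gt_eqF// powR_gt0// delta_gt0.
  exact: close.
(* The bound [nearB] holds only within [eta] of the boundary. From index [J] on the scale is below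
   [eta], and the sequence is shifted because domination is required at every index. *)
have [J _ hJ] := near_infty_natSinv_lt (PosNum eta0).
rewrite -(cvg_shiftn J).
have mh : measurable_fun (D : set (surf_space R n)) h.
  by apply/measurable_EFinP; exact: measurable_int hh.
have mgsnd : measurable_fun
    (D `*` Omega : set (surf_space R n * leb_space R n)%type) (fun p => g p.2).
  apply: (measurable_comp mO _ (proj1 Lg)) => [_ [p [? ?] <-]//|].
  exact: measurable_funTS.
apply: (@dominated_Rintegral_cvg _ (surf_space R n) R (surf R n) D
  (fun k z => h z * Mo (k + J)%N z) (fun z => h z * nd z) (fun z => B * `|h z|) mD).
- move=> k; apply: measurable_funM; first exact: mh.
  have [mk _ _ _] := hM (k + J)%N.
  apply: (@measurable_Rintegral_slice _ _ (surf_space R n) (leb_space R n) R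
    (leb R n) D Omega (fun z y => kap (k + J)%N z y * g y) (leb_sigma_finite R n) mD mO).
  exact: measurable_funM mk mgsnd.
- apply: measurable_funM; first exact: mh.
  (* Defined as a limit, [nd] is not visibly measurable; its integral formula is. *)
  apply: (@eq_measurable_fun _ _ (surf_space R n) _ D (fun z => \int[leb R n]_(y in Omega) (DG z y * psi y))).
    by move=> z; rewrite inE => Dz; rewrite /nd normal_derivativeE.
  apply: (@measurable_Rintegral_slice _ _ (surf_space R n) (leb_space R n) R
    (leb R n) D Omega (fun z y => DG z y * psi y) (leb_sigma_finite R n) mD mO).
  apply: measurable_funM; first exact: measurable_DG.
  apply: (measurable_comp mO _ (proj1 Lpsi)) => [_ [p [? ?] <-]//|].
  exact: measurable_funTS.
- apply: aeW => z Dz; apply: cvgM; first exact: cvg_cst.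
  rewrite (cvg_shiftn J (Mo ^~ z)).
  apply/cvgrPdist_le => e e0.
  (* At scales below [t] the mollifier at [z] sees only points where [w] is within [e] of [nd z]. *)
  have := green_op_boundary_limit tpsi Dz; rewrite -(normal_derivativeE tpsi Dz).
  move=> /cvgrPdist_lt/(_ _ e0)/nbhs_ballP[t /= t0 ht].
  apply: filterS (near_infty_natSinv_lt (PosNum t0)) => j jt.
  rewrite distrC; apply: Mo_close => // y Oy zy.
  rewrite distrC ltW//; apply: ht => //.
  by rewrite -ball_normE /=; exact: lt_trans zy jt.
- have ih := integrable_abse hh.
  exact: (integrableZl mD B ih).
(* Comparison with the value 0 turns [Mo_close] into the bound [|Mo| <= B]. *)
- move=> k z Dz; rewrite normrM mulrC ler_wpM2r// -[Mo _ _]subr0.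
  apply: Mo_close => // y Oy zy; rewrite subr0; apply: nearB Dz Oy _.
  apply: lt_trans zy _; apply: hJ; exact: leq_addl.
Qed.

End boundary_behaviour.

Theorem theorem4p6 (R : realType) (n : nat) (hn : (0 < n)%N)
    (Omega : set 'rV[R]_n) (hOmega : smooth_bounded_domain Omega)
    (s gamma : R) (G : 'rV[R]_n -> 'rV[R]_n -> R)
    (hG : green_kernel Omega s gamma G)
    (DG : 'rV[R]_n -> 'rV[R]_n -> R)
    (hDG : normal_derivative_kernel Omega gamma G DG) :
  exists C : R, forall h : 'rV[R]_n -> R, L1_bnd Omega h ->
  exists u : 'rV[R]_n -> R,
    [/\ L1_loc Omega u /\ weak_dual_solution Omega gamma G h u,
        forall v : 'rV[R]_n -> R,
          L1_loc Omega v -> weak_dual_solution Omega gamma G h v ->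
          \forall x \ae leb R n, Omega x -> v x = u x,
        \forall x \ae leb R n, Omega x ->
          (u x)%:E = (\int[surf R n]_(z in boundary Omega)
                        (DG z x * h z)%:E)%E,
        forall K : set 'rV[R]_n, compact_in Omega K ->
          ('N[leb R n]_+oo[EFin \o (u \_ K)] <=
           (C * set_dist K (boundary Omega) `^ (2 * s - n%:R - gamma))%:E *
           \int[surf R n]_(z in boundary Omega) `|(h z)%:E|)%E &
        {within boundary Omega, continuous h} ->
          exists f_ : nat -> 'rV[R]_n -> R,
            (forall j, L1_weighted Omega gamma (f_ j)) /\
            weak_cvg_L1_loc Omega (fun j => green_op Omega G (f_ j)) u].
Proof.
have [Oopen _ Onempty Obdd _] := hOmega.
have D0 := boundary_nonempty Oopen hn Obdd Onempty.
(* The constant of the estimate is that of the kernel, fixed before [h] and [K]. It is also the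
   truncation level in [poisson]. *)
have [C C0 hC] := green_normalized_bound Oopen D0 hG.
exists C => h hh; exists (poisson Omega s gamma DG C h).
have L1u : L1_loc Omega (poisson Omega s gamma DG C h).
  exact: (poisson_L1_loc hn Oopen Obdd D0 hG hDG C0 hC hh).
have wu : weak_dual_solution Omega gamma G h (poisson Omega s gamma DG C h).
  exact: (poisson_weak_dual_solution hn Oopen Obdd D0 hG hDG C0 hC hh).
split.
- by [].
- move=> v L1v wv.
  exact: (weak_dual_solution_unique Oopen Obdd D0 L1u L1v wu wv).
- exact: (poisson_representation Oopen D0 hDG C0 hC hh).
- move=> K cK.
  exact: (poisson_Linfty_norm Oopen D0 hG hDG C0 hh cK).
- move=> _.
  exact: (poisson_approximation hn Oopen Obdd D0 hG hDG C0 hC hh).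
Qed.
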